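(* Let $|\Sigma|=2$, let $d\ge 1$ and $n\ge 1$ be integers with $d\le\frac{n+1}{2}$, and let $\mathbf{P}:\Sigma^n\to[0,1]$ be a probability distribution. There is an algebraic variety $\mathcal{N}_d\subset\mathbb{R}^{d^2+d-1}$ with $\dim\mathcal{N}_d<d^2+d-1$ and an algorithmic routine $A$ which, when given $\mathbf{P}$ as input, outputs $$A(\mathbf{P})=\begin{cases}\text{'HMP on $d$ hidden states'} & \text{if } \mathbf{P}\in\mathbf{f}_{n,d}(\mathcal{H}_{d,+}\setminus\mathcal{N}_d),\\ \text{'Cannot decide'} & \text{if } \mathbf{P}\in\mathbf{f}_{n,d}(\mathcal{N}_d),\\ \text{'No HMP on $d$ hidden states'} & \text{otherwise.}\end{cases}$$ In the first case, $A$ also outputs the parametrization (an element of $\mathcal{H}_{d,+}$ mapped to $\mathbf{P}$ by $\mathbf{f}_{n,d}$), which is unique up to permutation of hidden states.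
   Context: $\Sigma$ is a finite alphabet and $\Sigma^n$ is the set of strings of length $n$ over $\Sigma$. A hidden Markov process (HMP) on $d$ hidden states with values in $\Sigma$ is parametrized by a triple $(M,E,\pi)$, where $M=[m_{s\bar s}]\in\mathbb{R}^{d\times d}$ is a nonnegative matrix with unit row sums (transition matrix), $E=[e_{sa}]\in\mathbb{R}^{d\times\Sigma}$ is a nonnegative matrix with unit row sums (emission matrix), and $\pi\in\mathbb{R}^d$ is a probability vector (initial distribution). $\mathcal{H}_{d,+}$ is the set of all such triples. Eliminating the row-sum constraints and the constraint $\sum_s\pi_s=1$, one regards $\mathcal{H}_{d,+}$ as a full-dimensional subset of $\mathbb{R}^{d(d-1)+d(|\Sigma|-1)+(d-1)}$, which is $\mathbb{R}^{d^2+d-1}$ for $|\Sigma|=2$. For $a\in\Sigma$ put $O_a=\mathrm{diag}(e_{1a},\dots,e_{da})$ and $T_a=O_aM$. For $v=a_1\cdots a_n$ put $T_v=T_{a_1}\cdots T_{a_n}$, and let $\mathbf{1}=(1,\dots,1)'\in\mathbb{R}^d$ (with $'$ denoting transposition). The map $\mathbf{f}_{n,d}$ is the polynomial map sending $(M,E,\pi)$ to $(\pi'T_v\mathbf{1})_{v\in\Sigma^n}$; it is defined by the same formula on all of $\mathbb{R}^{d^2+d-1}$ (that is, without the nonnegativity constraints). A distribution $\mathbf{P}$ is identified with the vector $(\mathbf{P}(v))_{v\in\Sigma^n}$. A permutation of the hidden states acts by simultaneously permuting the rows and columns of $M$, the rows of $E$ and the entries of $\pi$. *)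

(* Defs.v *)
From mathcomp Require Import all_boot all_order all_algebra all_fingroup.
From mathcomp Require Import classical_sets reals.
From mathcomp Require Import polyrcf.
From mathcomp Require Import mpoly.

Set Implicit Arguments.
Unset Strict Implicit.
Unset Printing Implicit Defensive.

Import Order.TTheory GRing.Theory Num.Theory.

Local Open Scope classical_set_scope.
Local Open Scope ring_scope.

(** * Hidden Markov processes *)

(** The letter [a] labels column [enum_rank a] of the emission matrix. No
    constraint is imposed here: the word function below is defined for
    arbitrary real entries. *)
Record hmp_triple (R : Type) (Sigma : finType) (d : nat) := HmpTriple {
  trans : 'M[R]_d;
  emis : 'M[R]_(d, #|Sigma|);
  init : 'cV[R]_d
}.

Section HMP.
Variables (R : realType) (Sigma : finType) (d : nat).
Implicit Types (t : hmp_triple R Sigma d) (a : Sigma).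

Definition is_hmp t : Prop :=
  [/\ (forall i j, 0 <= trans t i j) /\ (forall i, \sum_j trans t i j = 1),
      (forall s b, 0 <= emis t s b) /\ (forall s, \sum_b emis t s b = 1)
    & (forall s, 0 <= init t s 0) /\ \sum_s init t s 0 = 1].

Definition emis_diag t a : 'M[R]_d :=
  diag_mx (\row_s emis t s (enum_rank a)).

Definition letter_mx t a : 'M[R]_d := emis_diag t a *m trans t.

Definition word_mx t (v : seq Sigma) : 'M[R]_d :=
  \big[mulmx/1%:M]_(a <- v) letter_mx t a.

Definition word_prob n t : {ffun n.-tuple Sigma -> R} :=
  [ffun v : n.-tuple Sigma =>
     ((init t)^T *m word_mx t v *m (const_mx 1 : 'cV[R]_d)) 0 0].

Definition permute_states (g : 'S_d) t : hmp_triple R Sigma d :=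
  HmpTriple (row_perm g (col_perm g (trans t)))
            (row_perm g (emis t))
            (row_perm g (init t)).

(** ** Coordinates obtained by eliminating the unit-sum constraints *)

(** Restores the last entry of a vector of length [m] whose entries sum
    to 1, given the first [m - 1] ones. *)
Definition complete_sum1 m (v : 'I_m.-1 -> R) (j : 'I_m) : R :=
  if insub (val j) is Some j' then v j' else 1 - \sum_k v k.

Definition param_dim (e q : nat) : nat := (e * e.-1 + e * q.-1 + e.-1)%N.

Notation D := (param_dim d #|Sigma|).

(** A point of [R^D] lists the first [d - 1] columns of the transition
    matrix (row by row), the first [#|Sigma| - 1] columns of the emission
    matrix (row by row), and the first [d - 1] entries of the initial
    distribution. *)
Definition triple_of (x : 'rV[R]_D) : hmp_triple R Sigma d :=
  let M : 'M_(d, d.-1) := vec_mx (lsubmx (lsubmx x)) in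
  let E : 'M_(d, #|Sigma|.-1) := vec_mx (rsubmx (lsubmx x)) in
  let p : 'rV_(d.-1) := rsubmx x in
  HmpTriple (\matrix_(i, j) complete_sum1 (M i) j)
            (\matrix_(s, b) complete_sum1 (E s) b)
            (\col_s complete_sum1 (p 0) s).

Definition Hplus : set 'rV[R]_D := [set x | is_hmp (triple_of x)].

Definition word_map n (x : 'rV[R]_D) : {ffun n.-tuple Sigma -> R} :=
  word_prob n (triple_of x).

End HMP.

Arguments Hplus R Sigma d : clear implicits.

Lemma param_dim2 d : (0 < d)%N -> param_dim d 2 = (d ^ 2 + d - 1)%N.
Proof.
case: d => // d _.
by rewrite /param_dim -mulnDr addn1 mulnn addnS subn1.
Qed.

Definition is_distribution (R : realType) (T : finType) (P : {ffun T -> R}) :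
  Prop := (forall v, 0 <= P v <= 1) /\ \sum_v P v = 1.

(** * Real algebraic sets and their dimension *)

Section Variety.
Variables (R : realType) (D : nat).
Implicit Types Z N : set 'rV[R]_D.

Definition algebraic Z : Prop :=
  exists I : set {mpoly R[D]}, Z = [set x | forall p, I p -> p.@[x 0] = 0].

Definition irreducible Z : Prop :=
  [/\ algebraic Z, Z !=set0
    & forall Z1 Z2, algebraic Z1 -> algebraic Z2 ->
        Z = Z1 `|` Z2 -> Z = Z1 \/ Z = Z2].

(** [C 0 < C 1 < ... < C m], irreducible algebraic subsets of [N] *)
Definition irreducible_chain N (C : nat -> set 'rV[R]_D) (m : nat) : Prop :=
  (forall i, (i <= m)%N -> irreducible (C i) /\ C i `<=` N) /\
  (forall i, (i < m)%N -> C i `<` C i.+1).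

(** The dimension of [N] is its Krull dimension in the Zariski topology: the
    supremum of the lengths [m] of such chains (minus infinity for the empty
    set). *)
Definition dim_lt N (k : nat) : Prop :=
  forall C m, irreducible_chain N C m -> (m < k)%N.

End Variety.

(** * Algorithms over the reals

    Programs over real registers in the style of Blum, Shub and Smale: exact
    field arithmetic, sign tests, loops, and rational constants only. Since
    reading off the parameters of a hidden Markov process requires
    eigenvalues, extracting a real root of a univariate polynomial whose
    coefficients have been computed is also a basic step. *)

Inductive expr : Type :=
| EVar of nat
| ECst of rat
| EAdd of expr & expr
| EOpp of expr
| EMul of expr & expr
| EInv of expr.

(** [PRoot r cs k] stores in register [r] the real root of rank [k], counted
    from 0 in increasing order and without multiplicity, of the polynomial
    whose coefficients are, from degree 0 on, the contents of the registers
    listed in [cs]; it stores 0 if there is no such root or the polynomial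
    is 0. The tests of [PIf] and [PWhile] are [0 <= e]. *)
Inductive program : Type :=
| PSkip
| PAssign of nat & expr
| PRoot of nat & seq nat & nat
| PSeq of program & program
| PIf of expr & program & program
| PWhile of expr & program.

Section Semantics.
Variable R : realType.

Definition store := nat -> R.
Implicit Types s : store.

Fixpoint eval s (e : expr) : R :=
  match e with
  | EVar r => s r
  | ECst c => ratr c
  | EAdd e1 e2 => eval s e1 + eval s e2
  | EOpp e1 => - eval s e1
  | EMul e1 e2 => eval s e1 * eval s e2
  | EInv e1 => (eval s e1)^-1
  end.

Definition update s (r : nat) (c : R) : store :=
  fun r' => if r' == r then c else s r'.

Definition nth_real_root s (cs : seq nat) (k : nat) : R :=
  nth 0 (rootsR (Poly [seq s r | r <- cs])) k.

(** [exec A s s'] : started in store [s], [A] halts in store [s']. *)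
Inductive exec : program -> store -> store -> Prop :=
| ExSkip s : exec PSkip s s
| ExAssign r e s : exec (PAssign r e) s (update s r (eval s e))
| ExRoot r cs k s : exec (PRoot r cs k) s (update s r (nth_real_root s cs k))
| ExSeq A B s1 s2 s3 : exec A s1 s2 -> exec B s2 s3 -> exec (PSeq A B) s1 s3
| ExIfTrue e A B s s' : 0 <= eval s e -> exec A s s' -> exec (PIf e A B) s s'
| ExIfFalse e A B s s' : eval s e < 0 -> exec B s s' -> exec (PIf e A B) s s'
| ExWhileTrue e A s1 s2 s3 : 0 <= eval s1 e ->
    exec A s1 s2 -> exec (PWhile e A) s2 s3 -> exec (PWhile e A) s1 s3
| ExWhileFalse e A s : eval s e < 0 -> exec (PWhile e A) s s.

Lemma exec_det A s s1 s2 : exec A s s1 -> exec A s s2 -> s1 = s2.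
Proof.
move=> h; elim: h s2 => {A s s1}.
- by move=> s s2 h; inversion h.
- by move=> r e s s2 h; inversion h.
- by move=> r cs k s s2 h; inversion h.
- move=> A B s1 s2 s3 _ ihA _ ihB s4 h.
  inversion h as [| | |? ? ? t ? hA hB| | | |]; subst.
  by apply: ihB; rewrite (ihA _ hA).
- move=> e A B s s' e0 _ ih s2 h.
  inversion h as [| | | |? ? ? ? ? _ hA|? ? ? ? ? e1 _| |]; subst.
    exact: ih.
  by move: e1; rewrite ltNge e0.
- move=> e A B s s' e0 _ ih s2 h.
  inversion h as [| | | |? ? ? ? ? e1 _|? ? ? ? ? _ hB| |]; subst.
    by move: e0; rewrite ltNge e1.
  exact: ih.
- move=> e A s1 s2 s3 e0 _ ihA _ ihB s4 h.
  inversion h as [| | | | | |? ? ? t ? _ hA hB|? ? ? e1]; subst.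
    by apply: ihB; rewrite (ihA _ hA).
  by move: e1; rewrite ltNge e0.
- move=> e A s e0 s2 h.
  inversion h as [| | | | | |? ? ? ? ? e1 _ _|? ? ? _]; subst => //.
  by move: e0; rewrite ltNge e1.
Qed.

(** Input: the values of [P], in the order of [enum T], in registers
    0, 1, ...; every other register contains 0. *)
Definition input (T : finType) (P : {ffun T -> R}) : store :=
  fun r => nth 0 [seq P v | v : T] r.

(** Output: the verdict in register 0, and, where one is announced, a point
    of [R^D] in registers 1 to [D]. *)
Definition output_point D s : 'rV[R]_D := \row_(i < D) s i.+1.

End Semantics.

Inductive verdict := IsHMP | CannotDecide | NoHMP.

Definition verdict_code (v : verdict) : nat :=
  match v with NoHMP => 0 | IsHMP => 1 | CannotDecide => 2 end.

Definition answers (R : realType) (s : store R) (v : verdict) : Prop :=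
  s 0%N = (verdict_code v)%:R.

(* Main.v *)
(** Let [a0] be a letter, [e_s] the probability that state [s] emits it, and
    [H = (P(a0^(i+j)))_{i,j < d}], which only depends on [P]. Take for [N] the
    zero set of [det H * det M * prod_{s <> s'} (e_s - e_s')]. If [det H] is not
    0, two parametrizations of [P] are realizations of [P] that are similar by
    a matrix [S] fixing the vector of ones; if moreover [M] is invertible, [S]
    intertwines the diagonal matrices [T_{a0} M^-1], whose entries are the
    distinct [e_s], so [S] is a permutation matrix. Hence a point outside [N]
    has in its fibre only its permutations, none of them in [N].

    Functions separating the successive members of a chain of irreducible
    subsets of [N], together with an equation of [N], are algebraically
    independent; since the polynomials of degree at most [k] in [D] variables
    form a space of dimension [O(k^D)], there are at most [D] of them.

    The images of [N] and of its complement are projections of semialgebraic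
    sets defined over the rationals, so quantifier elimination decides them by
    sign tests on rational polynomials in the values of [P]. The coordinates of
    a point of a finite nonempty fibre are found one after the other: the
    possible values of the next one form a finite set defined by sign
    conditions, and each of them is a root of one of the nonzero polynomials
    occurring in these conditions. *)

Require Import Defs.
From mathcomp Require Import all_boot all_order all_algebra all_fingroup.
From mathcomp Require Import boolp classical_sets reals.
From mathcomp Require Import polyrcf mpoly.
From mathcomp Require Import zify.
From mathcomp Require qe_rcf qe_rcf_th.

Set Implicit Arguments.
Unset Strict Implicit.
Unset Printing Implicit Defensive.

Import Order.TTheory GRing.Theory Num.Theory.

Local Open Scope classical_set_scope.
Local Open Scope ring_scope.

(** * Quantifier elimination with rational constants *)

Notation tm := qe_rcf.term.
Notation fm := qe_rcf.formula.

(** Programs only have rational constants. The elimination of [qe_rcf] is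
    generic in the field; run over [rat] and mapped into [R], its output is the
    output over [R]. *)
Section RationalConstants.
Variable R : realType.

Fixpoint tmap (t : tm rat) : tm R :=
  match t with
  | qe_rcf.Var i => qe_rcf.Var _ i
  | qe_rcf.Const c => qe_rcf.Const (ratr c)
  | qe_rcf.NatConst n => qe_rcf.NatConst _ n
  | qe_rcf.Add a b => qe_rcf.Add (tmap a) (tmap b)
  | qe_rcf.Opp a => qe_rcf.Opp (tmap a)
  | qe_rcf.NatMul a n => qe_rcf.NatMul (tmap a) n
  | qe_rcf.Mul a b => qe_rcf.Mul (tmap a) (tmap b)
  | qe_rcf.Exp a n => qe_rcf.Exp (tmap a) n
  end.

Fixpoint fmap (f : fm rat) : fm R :=
  match f with
  | qe_rcf.Bool b => qe_rcf.Bool b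
  | qe_rcf.Equal a b => qe_rcf.Equal (tmap a) (tmap b)
  | qe_rcf.Lt a b => qe_rcf.Lt (tmap a) (tmap b)
  | qe_rcf.Le a b => qe_rcf.Le (tmap a) (tmap b)
  | qe_rcf.And f g => qe_rcf.And (fmap f) (fmap g)
  | qe_rcf.Or f g => qe_rcf.Or (fmap f) (fmap g)
  | qe_rcf.Implies f g => qe_rcf.Implies (fmap f) (fmap g)
  | qe_rcf.Not f => qe_rcf.Not (fmap f)
  end.

Notation ptmap := (map tmap).

(** The operations of [qe_rcf] are written in continuation-passing style, so each commutation with
    [fmap] is stated for two continuations that correspond under it. *)
Lemma fmap_Size p k k' : (forall n, fmap (k n) = k' n) ->
  fmap (qe_rcf.Size p k) = qe_rcf.Size (ptmap p) k'.
Proof.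
elim: p k k' => [|c p IH] k k' hk /=; first exact: hk.
by apply: IH => -[|n] //=; rewrite !hk.
Qed.

Lemma fmap_Isnull p k k' : (forall b, fmap (k b) = k' b) ->
  fmap (qe_rcf.Isnull p k) = qe_rcf.Isnull (ptmap p) k'.
Proof. by move=> hk; apply: fmap_Size => n; apply: hk. Qed.

Lemma fmap_LtSize p q k k' : (forall b, fmap (k b) = k' b) ->
  fmap (qe_rcf.LtSize p q k) = qe_rcf.LtSize (ptmap p) (ptmap q) k'.
Proof.
by move=> hk; apply: fmap_Size => n; apply: fmap_Size => m; apply: hk.
Qed.

Lemma fmap_LeadCoef p k k' : (forall t, fmap (k t) = k' (tmap t)) ->
  fmap (qe_rcf.LeadCoef p k) = qe_rcf.LeadCoef (ptmap p) k'.
Proof.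
elim: p k k' => [|c p IH] k k' hk /=; first by rewrite hk /= rmorph0.
by apply: IH => t /=; rewrite !hk.
Qed.

Lemma ptmap_AmulXn a n :
  ptmap (qe_rcf.AmulXn a n) = qe_rcf.AmulXn (tmap a) n.
Proof. by elim: n => //= n ->; rewrite rmorph0. Qed.

Lemma ptmap_AddPoly p q :
  ptmap (qe_rcf.AddPoly p q) = qe_rcf.AddPoly (ptmap p) (ptmap q).
Proof. by elim: p q => [|a p IH] [|b q] //=; rewrite IH. Qed.

Lemma ptmap_ScalPoly c p :
  ptmap (qe_rcf.ScalPoly c p) = qe_rcf.ScalPoly (tmap c) (ptmap p).
Proof. by elim: p => //= a p ->. Qed.

Lemma ptmap_MulPoly p q :
  ptmap (qe_rcf.MulPoly p q) = qe_rcf.MulPoly (ptmap p) (ptmap q).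
Proof.
by elim: p => //= a p IH; rewrite ptmap_AddPoly ptmap_ScalPoly /= IH.
Qed.

Lemma ptmap_ExpPoly p n :
  ptmap (qe_rcf.ExpPoly p n) = qe_rcf.ExpPoly (ptmap p) n.
Proof.
case: n => // n; rewrite /qe_rcf.ExpPoly /iterop.
by elim: n => //= n; rewrite ptmap_MulPoly => ->.
Qed.

Lemma ptmap_OppPoly p : ptmap (qe_rcf.OppPoly p) = qe_rcf.OppPoly (ptmap p).
Proof. by rewrite /qe_rcf.OppPoly ptmap_ScalPoly /= rmorphN1. Qed.

Lemma ptmap_Deriv p : ptmap (qe_rcf.Deriv p) = qe_rcf.Deriv (ptmap p).
Proof. by elim: p => //= a p IH; rewrite ptmap_AddPoly /= IH. Qed.

Lemma fmap_Rediv_rec_loop q sq cq c qq r n k k' :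
  (forall c qq r, fmap (k (c, qq, r)) = k' (c, ptmap qq, ptmap r)) ->
  fmap (qe_rcf.Rediv_rec_loop q sq cq c qq r n k) =
  qe_rcf.Rediv_rec_loop (ptmap q) sq (tmap cq) c (ptmap qq) (ptmap r) n k'.
Proof.
move=> hk; elim: n c qq r => [|n IH] c qq r /=; apply: fmap_Size => m;
  case: ifP => _ //; apply: fmap_LeadCoef => t.
  by rewrite hk /= !(ptmap_AddPoly, ptmap_MulPoly, ptmap_AmulXn, ptmap_OppPoly).
by rewrite IH !(ptmap_AddPoly, ptmap_MulPoly, ptmap_AmulXn, ptmap_OppPoly).
Qed.

Lemma fmap_Rediv p q k k' :
  (forall c qq r, fmap (k (c, qq, r)) = k' (c, ptmap qq, ptmap r)) ->
  fmap (qe_rcf.Rediv p q k) = qe_rcf.Rediv (ptmap p) (ptmap q) k'.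
Proof.
move=> hk; apply: fmap_Isnull => -[]; first by rewrite hk /= rmorph0.
apply: fmap_Size => sq; apply: fmap_Size => sp; apply: fmap_LeadCoef => t.
by rewrite (@fmap_Rediv_rec_loop _ _ _ _ _ _ _ _ k') //= rmorph0.
Qed.

Lemma fmap_Rgcd_loop n p q k k' : (forall r, fmap (k r) = k' (ptmap r)) ->
  fmap (qe_rcf.Rgcd_loop n p q k) = qe_rcf.Rgcd_loop n (ptmap p) (ptmap q) k'.
Proof.
move=> hk; elim: n p q => [|n IH] p q /=; apply: fmap_Rediv => c s r;
  by apply: fmap_Isnull => -[] /=.
Qed.

Lemma fmap_Rgcd p q k k' : (forall r, fmap (k r) = k' (ptmap r)) ->
  fmap (qe_rcf.Rgcd p q k) = qe_rcf.Rgcd (ptmap p) (ptmap q) k'.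
Proof.
move=> hk; apply: fmap_LtSize => -[]; apply: fmap_Isnull => -[] //;
  by apply: fmap_Size => n; apply: fmap_Rgcd_loop.
Qed.

Lemma fmap_BigRgcd ps k k' : (forall r, fmap (k r) = k' (ptmap r)) ->
  fmap (qe_rcf.BigRgcd ps k) = qe_rcf.BigRgcd (map ptmap ps) k'.
Proof.
elim: ps k k' => [|p ps IH] k k' hk /=; first by rewrite hk /= rmorph0.
by apply: IH => r; apply: fmap_Rgcd.
Qed.

Lemma fmap_Changes s k k' : (forall n, fmap (k n) = k' n) ->
  fmap (qe_rcf.Changes s k) = qe_rcf.Changes (ptmap s) k'.
Proof.
elim: s k k' => [|a s IH] k k' hk /=; first exact: hk.
by apply: IH => n /=; rewrite !hk; case: (s).
Qed.

Lemma fmap_SeqPInfty ps k k' : (forall s, fmap (k s) = k' (ptmap s)) ->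
  fmap (qe_rcf.SeqPInfty ps k) = qe_rcf.SeqPInfty (map ptmap ps) k'.
Proof.
elim: ps k k' => [|p ps IH] k k' hk /=; first exact: hk.
by apply: fmap_LeadCoef => t; apply: IH => s; rewrite hk.
Qed.

Lemma fmap_SeqMInfty ps k k' : (forall s, fmap (k s) = k' (ptmap s)) ->
  fmap (qe_rcf.SeqMInfty ps k) = qe_rcf.SeqMInfty (map ptmap ps) k'.
Proof.
elim: ps k k' => [|p ps IH] k k' hk /=; first exact: hk.
apply: fmap_LeadCoef => t; apply: fmap_Size => n; apply: IH => s.
by rewrite hk /= rmorphN1.
Qed.

Lemma fmap_ChangesPoly ps k k' : (forall n, fmap (k n) = k' n) ->
  fmap (qe_rcf.ChangesPoly ps k) = qe_rcf.ChangesPoly (map ptmap ps) k'.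
Proof.
move=> hk; apply: fmap_SeqMInfty => s; apply: fmap_SeqPInfty => s'.
by apply: fmap_Changes => n; apply: fmap_Changes => m.
Qed.

Lemma fmap_NextMod p q k k' : (forall r, fmap (k r) = k' (ptmap r)) ->
  fmap (qe_rcf.NextMod p q k) = qe_rcf.NextMod (ptmap p) (ptmap q) k'.
Proof.
move=> hk; apply: fmap_LeadCoef => t; apply: fmap_Rediv => c s r.
by apply: fmap_Rediv => c' s' r' /=; rewrite hk ptmap_ScalPoly.
Qed.

Lemma fmap_ModsAux p q n k k' : (forall r, fmap (k r) = k' (map ptmap r)) ->
  fmap (qe_rcf.ModsAux p q n k) = qe_rcf.ModsAux (ptmap p) (ptmap q) n k'.
Proof.
elim: n p q k k' => [|n IH] p q k k' hk /=; first exact: hk.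
apply: fmap_Isnull => -[]; first exact: hk.
by apply: fmap_NextMod => r; apply: IH => s; rewrite hk.
Qed.

Lemma fmap_Mods p q k k' : (forall r, fmap (k r) = k' (map ptmap r)) ->
  fmap (qe_rcf.Mods p q k) = qe_rcf.Mods (ptmap p) (ptmap q) k'.
Proof.
by move=> hk; apply: fmap_Size => n; apply: fmap_Size => m; apply: fmap_ModsAux.
Qed.

Lemma ptmap_PolyComb sq sc :
  ptmap (qe_rcf.PolyComb sq sc) = qe_rcf.PolyComb (map ptmap sq) sc.
Proof.
rewrite /qe_rcf.PolyComb size_map; elim: (iota _ _) => //= i s IH.
rewrite ptmap_MulPoly IH ptmap_ExpPoly.
congr (qe_rcf.MulPoly (qe_rcf.ExpPoly _ _) _).
have [h|h] := ltnP i (size sq); first by rewrite (nth_map [::]).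
by rewrite !nth_default ?size_map.
Qed.

Lemma ptmap_Pcq sq i :
  ptmap (qe_rcf.Pcq sq i) = qe_rcf.Pcq (map ptmap sq) i.
Proof.
rewrite /qe_rcf.Pcq size_map.
have [h|h] := ltnP i (size (qe_rcf_th.sg_tab (size sq))); last first.
  by rewrite !nth_default ?size_map.
by rewrite !(nth_map [::]) // ptmap_PolyComb.
Qed.

Lemma fmap_TaqsR p sq i k k' : (forall t, fmap (k t) = k' (tmap t)) ->
  fmap (qe_rcf.TaqsR p sq i k) = qe_rcf.TaqsR (ptmap p) (map ptmap sq) i k'.
Proof.
move=> hk; rewrite /qe_rcf.TaqsR /qe_rcf.TaqR /qe_rcf.bind_def -ptmap_Pcq.
rewrite -ptmap_Deriv -ptmap_MulPoly; apply: fmap_Mods => r.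
by apply: fmap_ChangesPoly => n; rewrite hk /= rmorph_int.
Qed.

(** These coefficients are entries of the inverse of an integer matrix, and inversion commutes with
    the embedding of the rationals. *)
Lemma ratr_coefs n i : ratr (qe_rcf_th.coefs rat n i) = qe_rcf_th.coefs R n i.
Proof.
rewrite /qe_rcf_th.coefs.
have [h|h] := ltnP i (3 ^ n); last first.
  by rewrite !nth_default ?rmorph0 // size_map size_enum_ord.
have o : 'I_(3 ^ n) := Ordinal h.
have hs : (i < size (enum 'I_(3 ^ n)))%N by rewrite size_enum_ord.
rewrite !(nth_map o _ _ hs) !castmxE.
have -> : invmx (map_mx (intr : int -> R) (qe_rcf_th.ctmat n)) =
  map_mx ratr (invmx (map_mx (intr : int -> rat) (qe_rcf_th.ctmat n))).
  rewrite map_invmx; congr invmx; apply/matrixP => a b.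
  by rewrite !mxE rmorph_int.
by rewrite [RHS]mxE.
Qed.

Lemma tmap_Coefs n i : tmap (qe_rcf.Coefs _ n i) = qe_rcf.Coefs R n i.
Proof.
rewrite /qe_rcf.Coefs /=; congr qe_rcf.Const.
case: n => [|[|n]]; last exact: ratr_coefs.
  exact: rmorph_nat.
by case: i => [|[|[|i]]] /=; rewrite ?nth_nil ?rmorph0 // fmorphV rmorph_nat.
Qed.

Lemma fmap_CcountWeak p sq k k' : (forall t, fmap (k t) = k' (tmap t)) ->
  fmap (qe_rcf.CcountWeak p sq k) =
  qe_rcf.CcountWeak (ptmap p) (map ptmap sq) k'.
Proof.
move=> hk; rewrite /qe_rcf.CcountWeak size_map.
set aux := (fix aux s i k := match i with 0 => _ | _ => _ end).
set aux' := (fix aux s i k := match i with 0 => _ | _ => _ end).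
(* The induction on the loop needs an arbitrary accumulator in place of the initial 0. *)
rewrite -[qe_rcf.NatConst R 0]/(tmap (qe_rcf.NatConst _ 0)).
move: (qe_rcf.NatConst _ 0) => s.
elim: (3 ^ _)%N s => [|n IH] s /=; first exact: hk.
apply: fmap_TaqsR => t.
rewrite -(tmap_Coefs (size sq) n) -/(tmap (qe_rcf.Add (qe_rcf.Mul _ _) _)).
by rewrite IH.
Qed.

Lemma ptmap_BoundingPoly sq :
  ptmap (qe_rcf.BoundingPoly sq) = qe_rcf.BoundingPoly (map ptmap sq).
Proof.
rewrite /qe_rcf.BoundingPoly ptmap_Deriv; congr qe_rcf.Deriv.
by elim: sq => //= q sq IH; rewrite ptmap_MulPoly IH.
Qed.

Lemma fmap_CcountGt0 sp sq :
  fmap (qe_rcf.CcountGt0 sp sq) =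
  qe_rcf.CcountGt0 (map ptmap sp) (map ptmap sq).
Proof.
apply: fmap_BigRgcd => r; apply: fmap_Isnull => -[] /=; last first.
  exact: fmap_CcountWeak.
rewrite /qe_rcf.bind_def -ptmap_BoundingPoly; apply: fmap_CcountWeak => t /=.
congr (qe_rcf.Or _ (qe_rcf.Or _ _)); rewrite /qe_rcf.bind_def.
  by elim: sq => //= q sq <-; congr qe_rcf.And; apply: fmap_LeadCoef.
elim: sq => //= q sq <-; congr qe_rcf.And.
by apply: fmap_Size => n; apply: fmap_LeadCoef.
Qed.

Lemma ptmap_abstrX i t : ptmap (qe_rcf.abstrX i t) = qe_rcf.abstrX i (tmap t).
Proof.
elim: t => //=.
- by move=> n; case: ifP.
- by move=> a IHa b IHb; rewrite ptmap_AddPoly IHa IHb.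
- by move=> a IH; rewrite ptmap_OppPoly IH.
- by move=> a IH n; rewrite /qe_rcf.NatMulPoly ptmap_ScalPoly IH.
- by move=> a IHa b IHb; rewrite ptmap_MulPoly IHa IHb.
- by move=> a IH n; rewrite ptmap_ExpPoly IH.
Qed.

End RationalConstants.

(** * Definable sets of stores *)

Section Definability.
Variable R : realType.
Implicit Types (s : store R) (t : tm rat) (f g : fm rat).

(** Terms are evaluated directly on stores, whereas [qe_rcf] uses finite environments; [eval_mkseq]
    compares the two. *)
Fixpoint teval s t : R :=
  match t with
  | qe_rcf.Var i => s i
  | qe_rcf.Const c => ratr c
  | qe_rcf.NatConst n => n%:R
  | qe_rcf.Add a b => teval s a + teval s b
  | qe_rcf.Opp a => - teval s a
  | qe_rcf.NatMul a n => teval s a *+ n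
  | qe_rcf.Mul a b => teval s a * teval s b
  | qe_rcf.Exp a n => teval s a ^+ n
  end.

Fixpoint fholds s f : bool :=
  match f with
  | qe_rcf.Bool b => b
  | qe_rcf.Equal a b => teval s a == teval s b
  | qe_rcf.Lt a b => teval s a < teval s b
  | qe_rcf.Le a b => teval s a <= teval s b
  | qe_rcf.And f g => fholds s f && fholds s g
  | qe_rcf.Or f g => fholds s f || fholds s g
  | qe_rcf.Implies f g => fholds s f ==> fholds s g
  | qe_rcf.Not f => ~~ fholds s f
  end.

(** All variables of the term have an index below this bound, so a store can be truncated there to a
    finite environment. *)
Fixpoint tbound t : nat :=
  match t with
  | qe_rcf.Var i => i.+1
  | qe_rcf.Const _ | qe_rcf.NatConst _ => 0
  | qe_rcf.Add a b | qe_rcf.Mul a b => maxn (tbound a) (tbound b)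
  | qe_rcf.Opp a | qe_rcf.NatMul a _ | qe_rcf.Exp a _ => tbound a
  end.

Fixpoint fbound f : nat :=
  match f with
  | qe_rcf.Bool _ => 0
  | qe_rcf.Equal a b | qe_rcf.Lt a b | qe_rcf.Le a b =>
      maxn (tbound a) (tbound b)
  | qe_rcf.And f g | qe_rcf.Or f g | qe_rcf.Implies f g =>
      maxn (fbound f) (fbound g)
  | qe_rcf.Not f => fbound f
  end.

Lemma teval_agree K t s s' : (tbound t <= K)%N ->
  (forall i, (i < K)%N -> s i = s' i) -> teval s t = teval s' t.
Proof.
move=> + h.
elim: t => [n|c|n|a IHa b IHb|a IHa|a IHa n|a IHa b IHb|a IHa n] //=.
- exact: h.
- by rewrite geq_max => /andP[/IHa-> /IHb->].
- by move=> h1; rewrite IHa.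
- by move=> h1; rewrite IHa.
- by rewrite geq_max => /andP[/IHa-> /IHb->].
- by move=> h1; rewrite IHa.
Qed.

Lemma fholds_agree K f s s' : (fbound f <= K)%N ->
  (forall i, (i < K)%N -> s i = s' i) -> fholds s f = fholds s' f.
Proof.
move=> + h; have ht := teval_agree _ h.
elim: f => //=; do ?by move=> a b; rewrite geq_max => /andP[/ht-> /ht->].
- by move=> f IHf g IHg; rewrite geq_max => /andP[/IHf-> /IHg->].
- by move=> f IHf g IHg; rewrite geq_max => /andP[/IHf-> /IHg->].
- by move=> f IHf g IHg; rewrite geq_max => /andP[/IHf-> /IHg->].
- by move=> f IHf /IHf->.
Qed.

Lemma eval_mkseq K t s : (tbound t <= K)%N ->
  qe_rcf.eval (mkseq s K) (tmap R t) = teval s t.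
Proof.
elim: t => [n|c|n|a IHa b IHb|a IHa|a IHa n|a IHa b IHb|a IHa n] //=.
- by move=> h; rewrite nth_mkseq.
- by rewrite geq_max => /andP[/IHa-> /IHb->].
- by move=> h1; rewrite IHa.
- by move=> h1; rewrite IHa.
- by rewrite geq_max => /andP[/IHa-> /IHb->].
- by move=> h1; rewrite IHa.
Qed.

Lemma qf_eval_mkseq K f s : (fbound f <= K)%N ->
  qe_rcf.qf_eval (mkseq s K) (fmap R f) = fholds s f.
Proof.
elim: f => //=;
  do ?by move=> a b; rewrite geq_max => /andP[ha hb]; rewrite !eval_mkseq.
- by move=> f IHf g IHg; rewrite geq_max => /andP[/IHf-> /IHg->].
- by move=> f IHf g IHg; rewrite geq_max => /andP[/IHf-> /IHg->].
- by move=> f IHf g IHg; rewrite geq_max => /andP[/IHf-> /IHg->].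
- by move=> f IHf /IHf->.
Qed.

Lemma mkseq_update K s i x : (i < K)%N ->
  set_nth 0 (mkseq s K) i x = mkseq (update s i x) K.
Proof.
move=> iK; apply: (@eq_from_nth _ 0).
  by rewrite size_set_nth !size_mkseq (maxn_idPr iK).
move=> j; rewrite size_set_nth size_mkseq (maxn_idPr iK) => jK.
by rewrite nth_set_nth /= !nth_mkseq.
Qed.

(** Terms required to vanish, then terms required to be positive: the systems that
    [qe_rcf.CcountGt0] decides in one variable. *)
Definition clause := (seq (tm rat) * seq (tm rat))%type.

Definition sat_clause s (c : clause) : bool :=
  all (fun t => teval s t == 0) c.1 && all (fun t => 0 < teval s t) c.2.

Definition conj_dnf (C D : seq clause) : seq clause :=
  [seq (c.1 ++ d.1, c.2 ++ d.2) | c <- C, d <- D].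

Lemma has_conj_dnf s C D : has (sat_clause s) (conj_dnf C D) =
  has (sat_clause s) C && has (sat_clause s) D.
Proof.
elim: C => //= c C IH; rewrite has_cat IH andb_orl; congr (_ || _).
rewrite has_map; elim: D {IH} => [|d D IH] /=; first by rewrite andbF.
rewrite IH andb_orr; congr (_ || _).
by rewrite /sat_clause /= !all_cat andbACA.
Qed.

Definition tsub (a b : tm rat) : tm rat := qe_rcf.Add a (qe_rcf.Opp b).

(** A disjunctive normal form of [f] if [b] is true and of its negation otherwise; clauses have no
    negation, so it is pushed down to the atoms. *)
Fixpoint dnf (b : bool) f : seq clause :=
  match f with
  | qe_rcf.Bool c => if b == c then [:: ([::], [::])] else [::]
  | qe_rcf.Equal t u =>
      if b then [:: ([:: tsub t u], [::])]
      else [:: ([::], [:: tsub t u]); ([::], [:: tsub u t])]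
  | qe_rcf.Lt t u =>
      if b then [:: ([::], [:: tsub u t])]
      else [:: ([:: tsub t u], [::]); ([::], [:: tsub t u])]
  | qe_rcf.Le t u =>
      if b then [:: ([:: tsub u t], [::]); ([::], [:: tsub u t])]
      else [:: ([::], [:: tsub t u])]
  | qe_rcf.And f g => (if b then conj_dnf else cat) (dnf b f) (dnf b g)
  | qe_rcf.Or f g => (if b then cat else conj_dnf) (dnf b f) (dnf b g)
  | qe_rcf.Implies f g =>
      (if b then cat else conj_dnf) (dnf (~~ b) f) (dnf b g)
  | qe_rcf.Not f => dnf (~~ b) f
  end.

Lemma dnfP s b f : has (sat_clause s) (dnf b f) = (b == fholds s f).
Proof.
elim: f b => /=.
- by move=> c []; case: c.
- by move=> t u []; rewrite /sat_clause /= ?andbT ?orbF ?subr_eq0 ?subr_gt0;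
    case: ltgtP.
- by move=> t u []; rewrite /sat_clause /= ?andbT ?orbF ?subr_eq0 ?subr_gt0;
    case: ltgtP.
- by move=> t u []; rewrite /sat_clause /= ?andbT ?orbF ?subr_eq0 ?subr_gt0;
    case: ltgtP.
- move=> f IHf g IHg []; rewrite ?has_conj_dnf ?has_cat IHf IHg;
  by case: (fholds s f); case: (fholds s g).
- move=> f IHf g IHg []; rewrite ?has_conj_dnf ?has_cat IHf IHg;
  by case: (fholds s f); case: (fholds s g).
- move=> f IHf g IHg []; rewrite ?has_conj_dnf ?has_cat IHf IHg;
  by case: (fholds s f); case: (fholds s g).
- by move=> f IHf b; rewrite IHf; case: b; case: (fholds s f).
Qed.

Definition elim_var i f : fm rat :=
  foldr (fun c g => qe_rcf.Or (qe_rcf.CcountGt0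
    (map (qe_rcf.abstrX i) c.1) (map (qe_rcf.abstrX i) c.2)) g)
    (qe_rcf.Bool false) (dnf true f).

Lemma horner_abstrX s i K t x : (i < K)%N -> (tbound t <= K)%N ->
  (qe_rcf.eval_poly (mkseq s K) (qe_rcf.abstrX i (tmap R t))).[x] =
  teval (update s i x) t.
Proof.
by move=> iK tK; rewrite qe_rcf.abstrXP mkseq_update // eval_mkseq.
Qed.

Definition sbound (l : seq (tm rat)) := foldr maxn 0%N (map tbound l).

Lemma all_horner_abstrX (P : pred R) s i K l x :
  (i < K)%N -> (sbound l <= K)%N ->
  all (fun p : {poly R} => P p.[x])
    (map (qe_rcf.eval_poly (mkseq s K))
      (map (map (tmap R)) (map (qe_rcf.abstrX i) l))) =
  all (fun t => P (teval (update s i x) t)) l.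
Proof.
move=> iK; elim: l => //= t l IH; rewrite geq_max => /andP[tK lK].
by rewrite IH // ptmap_abstrX horner_abstrX.
Qed.

(** The formula is computed over [rat], but its image under [fmap] is the one computed over [R], to
    which the correctness of the elimination over a real closed field applies. *)
Lemma fholds_CcountGt0 s i (c : clause) :
  fholds s (qe_rcf.CcountGt0 (map (qe_rcf.abstrX i) c.1)
                             (map (qe_rcf.abstrX i) c.2)) <->
  exists x, sat_clause (update s i x) c.
Proof.
set g := qe_rcf.CcountGt0 _ _.
pose K := maxn (maxn (fbound g) i.+1) (maxn (sbound c.1) (sbound c.2)).
have [gK iK c1K c2K] : [/\ (fbound g <= K)%N, (i < K)%N,
    (sbound c.1 <= K)%N & (sbound c.2 <= K)%N].
  by split; rewrite /K !leq_max leqnn ?orbT.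
rewrite -(qf_eval_mkseq _ gK) fmap_CcountGt0 qe_rcf.eval_CcountGt0.
split=> [/qe_rcf_th.ccount_gt0P[x]|[x hx]]; last apply/qe_rcf_th.ccount_gt0P.
  rewrite !big_all (all_horner_abstrX (pred1 0)) //.
  by rewrite (all_horner_abstrX (fun y => 0 < y)) //; exists x.
exists x; rewrite !big_all (all_horner_abstrX (pred1 0)) //.
by rewrite (all_horner_abstrX (fun y => 0 < y)).
Qed.

Lemma fholds_elim_var s i f :
  fholds s (elim_var i f) <-> exists x, fholds (update s i x) f.
Proof.
have -> : (exists x, fholds (update s i x) f) <->
    exists x, has (sat_clause (update s i x)) (dnf true f).
  by split=> -[x hx]; exists x; move: hx; rewrite dnfP; case: (fholds _ _).
rewrite /elim_var; elim: (dnf true f) => [|c C IH] /=.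
  by split=> // -[].
split=> [/orP[/fholds_CcountGt0[x hx]|/IH[x hx]]|[x /orP[hx|hx]]].
- by exists x; rewrite hx.
- by exists x; rewrite hx orbT.
- by apply/orP; left; apply/fholds_CcountGt0; exists x.
- by apply/orP; right; apply/IH; exists x.
Qed.

(** The defining formula is quantifier-free with rational constants, hence testable by a program.
    Closure under [exists] is the Tarski-Seidenberg principle, proved in [definable_ex]. *)
Definition definable (S : store R -> Prop) : Prop :=
  exists f, forall s, S s <-> fholds s f.

Definition polyfun (F : store R -> R) : Prop :=
  exists t, forall s, F s = teval s t.

Lemma definable_iff S S' : (forall s, S s <-> S' s) ->
  definable S -> definable S'.
Proof.
by move=> h [f hf]; exists f => s; rewrite -h.
Qed.

Lemma definable_and S S' : definable S -> definable S' ->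
  definable (fun s => S s /\ S' s).
Proof.
move=> [f hf] [g hg]; exists (qe_rcf.And f g) => s /=.
by split=> [[/hf-> /hg->]|/andP[/hf ? /hg ?]].
Qed.

Lemma definable_not S : definable S -> definable (fun s => ~ S s).
Proof.
move=> [f hf]; exists (qe_rcf.Not f) => s /=.
by split=> [h|/negP h /hf //]; apply/negP => /hf.
Qed.

Lemma definable_forall (I : finType) (S : I -> store R -> Prop) :
  (forall i, definable (S i)) -> definable (fun s => forall i, S i s).
Proof.
move=> h; suff [f hf] : definable (fun s => forall i, i \in enum I -> S i s).
  exists f => s; rewrite -hf; split=> // hs i; apply: hs; exact: mem_enum.
elim: (enum I) => [|i l [f hf]]; first by exists (qe_rcf.Bool true).
have [g hg] := h i; exists (qe_rcf.And g f) => s /=; split=> [hs|].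
  apply/andP; split; first by apply/hg/hs/mem_head.
  by apply/hf => j jl; apply: hs; rewrite inE jl orbT.
by case/andP => /hg ? /hf hs j; rewrite inE => /predU1P[->|/hs].
Qed.

Lemma definable_ex i S : definable S ->
  definable (fun s => exists x, S (update s i x)).
Proof.
move=> [f hf]; exists (elim_var i f) => s.
by split=> [[x /hf hx]|/fholds_elim_var[x /hf hx]];
  [apply/fholds_elim_var|]; exists x.
Qed.

Lemma definable_eq F G : polyfun F -> polyfun G ->
  definable (fun s => F s = G s).
Proof.
move=> [t ht] [u hu]; exists (qe_rcf.Equal t u) => s /=.
by rewrite ht hu; split=> /eqP.
Qed.

Lemma definable_le F G : polyfun F -> polyfun G ->
  definable (fun s => F s <= G s).
Proof.
by move=> [t ht] [u hu]; exists (qe_rcf.Le t u) => s /=; rewrite ht hu.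
Qed.

Lemma polyfun_var i : polyfun (fun s => s i).
Proof. by exists (qe_rcf.Var _ i). Qed.

Lemma polyfun_nat n : polyfun (fun=> n%:R).
Proof. by exists (qe_rcf.NatConst _ n). Qed.

Lemma polyfun_add F G : polyfun F -> polyfun G ->
  polyfun (fun s => F s + G s).
Proof.
by move=> [t ht] [u hu]; exists (qe_rcf.Add t u) => s /=; rewrite ht hu.
Qed.

Lemma polyfun_opp F : polyfun F -> polyfun (fun s => - F s).
Proof. by move=> [t ht]; exists (qe_rcf.Opp t) => s /=; rewrite ht. Qed.

Lemma polyfun_mul F G : polyfun F -> polyfun G ->
  polyfun (fun s => F s * G s).
Proof.
by move=> [t ht] [u hu]; exists (qe_rcf.Mul t u) => s /=; rewrite ht hu.
Qed.

Lemma polyfun_ext F G : F =1 G -> polyfun F -> polyfun G.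
Proof. by move=> FG [t ht]; exists t => s; rewrite -FG. Qed.

Lemma polyfun_sum (I : Type) (r : seq I) (P : pred I) (F : I -> store R -> R) :
  (forall i, polyfun (F i)) -> polyfun (fun s => \sum_(i <- r | P i) F i s).
Proof.
move=> h; elim: r => [|i r IH].
  by apply: polyfun_ext (polyfun_nat 0) => s; rewrite big_nil.
have h2 := polyfun_add (h i) IH.
by case Pi: (P i); [apply: polyfun_ext h2|apply: polyfun_ext IH] => s;
  rewrite big_cons Pi.
Qed.

Lemma polyfun_prod (I : Type) (r : seq I) (P : pred I) (F : I -> store R -> R) :
  (forall i, polyfun (F i)) -> polyfun (fun s => \prod_(i <- r | P i) F i s).
Proof.
move=> h; elim: r => [|i r IH].
  by apply: polyfun_ext (polyfun_nat 1) => s; rewrite big_nil.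
have h2 := polyfun_mul (h i) IH.
by case Pi: (P i); [apply: polyfun_ext h2|apply: polyfun_ext IH] => s;
  rewrite big_cons Pi.
Qed.

Definition polymx m n (A : store R -> 'M[R]_(m, n)) : Prop :=
  forall i j, polyfun (fun s => A s i j).

Lemma polymx_mul m n p (A : store R -> 'M[R]_(m, n))
    (B : store R -> 'M[R]_(n, p)) :
  polymx A -> polymx B -> polymx (fun s => A s *m B s).
Proof.
move=> hA hB i j; apply: (@polyfun_ext (fun s => \sum_k A s i k * B s k j)).
  by move=> s; rewrite mxE.
by apply: polyfun_sum => k; apply: polyfun_mul.
Qed.

Lemma polyfun_det n (A : store R -> 'M[R]_n) : polymx A ->
  polyfun (fun s => \det (A s)).
Proof.
move=> hA; rewrite /determinant; apply: polyfun_sum => g.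
apply: polyfun_mul; last exact: polyfun_prod.
by case: (odd_perm g); [apply: polyfun_opp (polyfun_nat 1)|
  apply: (polyfun_nat 1)].
Qed.

Lemma teval_tsub s a b : teval s (tsub a b) = teval s a - teval s b.
Proof. by []. Qed.

End Definability.

Arguments tsub : simpl never.

(** * Programs testing and solving sign conditions *)

Section Programs.
Variable R : realType.
Implicit Types (s : store R) (t : tm rat) (f : fm rat).

Fixpoint expr_of t : expr :=
  match t with
  | qe_rcf.Var i => EVar i
  | qe_rcf.Const c => ECst c
  | qe_rcf.NatConst n => ECst n%:R
  | qe_rcf.Add a b => EAdd (expr_of a) (expr_of b)
  | qe_rcf.Opp a => EOpp (expr_of a)
  | qe_rcf.NatMul a n => EMul (expr_of a) (ECst n%:R)
  | qe_rcf.Mul a b => EMul (expr_of a) (expr_of b)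
  | qe_rcf.Exp a n => iter n (EMul (expr_of a)) (ECst 1)
  end.

Lemma eval_expr_of s t : Defs.eval s (expr_of t) = teval s t.
Proof.
elim: t => //= [n|a -> b ->|a ->|a IH n|a -> b ->|a IH n] //.
- exact: rmorph_nat.
- by rewrite IH rmorph_nat mulr_natr.
- by elim: n => [|n IHn] /=; rewrite ?rmorph1 // IHn IH exprS.
Qed.

(** The only primitive test is [0 <= e]: an equality takes two nested tests, and a strict inequality
    is the failure of the reverse weak one. *)
Fixpoint branch f (A B : program) : program :=
  match f with
  | qe_rcf.Bool b => if b then A else B
  | qe_rcf.Equal t u =>
      PIf (expr_of (tsub t u)) (PIf (expr_of (tsub u t)) A B) B
  | qe_rcf.Lt t u => PIf (expr_of (tsub t u)) B A
  | qe_rcf.Le t u => PIf (expr_of (tsub u t)) A B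
  | qe_rcf.And f g => branch f (branch g A B) B
  | qe_rcf.Or f g => branch f A (branch g A B)
  | qe_rcf.Implies f g => branch f (branch g A B) A
  | qe_rcf.Not f => branch f B A
  end.

Lemma exec_PIf t A B s s' : exec (if 0 <= teval s t then A else B) s s' ->
  exec (PIf (expr_of t) A B) s s'.
Proof.
case: leP => h; first by apply: ExIfTrue; rewrite eval_expr_of.
by apply: ExIfFalse; rewrite eval_expr_of.
Qed.

Lemma exec_branch f A B s s' : exec (if fholds s f then A else B) s s' ->
  exec (branch f A B) s s'.
Proof.
elim: f A B => [b|t u|t u|t u|f IHf g IHg|f IHf g IHg|f IHf g IHg|f IHf] A B.
- by [].
- move=> h; apply: exec_PIf; rewrite teval_tsub subr_ge0.
  have [tu|ut] := leP (teval s u) (teval s t); last first.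
    by move: h; rewrite /= lt_eqF.
  by apply: exec_PIf; move: h; rewrite teval_tsub subr_ge0 /= eq_le tu andbT.
- move=> h; apply: exec_PIf; move: h; rewrite teval_tsub subr_ge0 /=.
  by case: ltP.
- by move=> h; apply: exec_PIf; rewrite teval_tsub subr_ge0.
- by move=> /= h; apply: IHf; case: (fholds s f) h => // h; apply: IHg.
- by move=> /= h; apply: IHf; case: (fholds s f) h => // h; apply: IHg.
- by move=> /= h; apply: IHf; case: (fholds s f) h => // h; apply: IHg.
- by move=> /= h; apply: IHf; case: (fholds s f) h.
Qed.

Fixpoint load (r : nat) (cs : seq (tm rat)) : program :=
  if cs is c :: cs' then PSeq (PAssign r (expr_of c)) (load r.+1 cs')
  else PSkip.

(** The terms read registers below [K] only, so writing their values from [r >= K] on does not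
    disturb the later ones. *)
Lemma exec_load K r cs s : (sbound cs <= K)%N -> (K <= r)%N ->
  exists s', [/\ exec (load r cs) s s',
    forall i, (i < r)%N -> s' i = s i &
    [seq s' i | i <- iota r (size cs)] = [seq teval s c | c <- cs]].
Proof.
elim: cs r s => [|c cs IH] r s /=; first by exists s; split=> //; apply: ExSkip.
rewrite geq_max => /andP[cK csK] Kr.
have [s' [h1 h2 h3]] := IH r.+1 (update s r (teval s c)) csK (leqW Kr).
exists s'; split.
- by apply: ExSeq h1; rewrite -eval_expr_of; apply: ExAssign.
- by move=> i ir; rewrite (h2 _ (leqW ir)) /update (ltn_eqF ir).
- rewrite h3 h2 // {1}/update eqxx; congr cons.
  have agr : forall i, (i < K)%N -> update s r (teval s c) i = s i.
    by move=> i iK; rewrite /update (ltn_eqF (leq_trans iK Kr)).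
  elim: (cs) csK => //= d ds IHd; rewrite geq_max => /andP[dK dsK].
  by rewrite IHd // (teval_agree dK agr).
Qed.

(** The term as a polynomial in register [i], the other registers being fixed by the store. *)
Definition upoly s i t : {poly R} :=
  Poly [seq teval s c | c <- qe_rcf.abstrX i t].

Lemma upolyE K s i t : (sbound (qe_rcf.abstrX i t) <= K)%N ->
  upoly s i t =
  qe_rcf.eval_poly (mkseq s K) (qe_rcf.abstrX i (tmap R t)).
Proof.
rewrite qe_rcf.eval_polyP -ptmap_abstrX -map_comp => h; congr Poly.
elim: (qe_rcf.abstrX i t) h => //= c cs IH.
by rewrite geq_max => /andP[cK csK]; rewrite IH // eval_mkseq.
Qed.

Lemma horner_upoly s i t x : (upoly s i t).[x] = teval (update s i x) t.
Proof.
pose K := maxn (sbound (qe_rcf.abstrX i t)) (maxn i.+1 (tbound t)).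
rewrite (@upolyE K) ?leq_max ?leqnn // horner_abstrX // /K.
  by rewrite !leq_max leqnn orbT.
by rewrite !leq_max leqnn !orbT.
Qed.

(** A nonzero polynomial does not vanish at its own Cauchy bound, whereas the difference vanishes
    everywhere. *)
Lemma poly_ext (p q : {poly R}) : (forall x, p.[x] = q.[x]) -> p = q.
Proof.
move=> h; apply/eqP; rewrite -subr_eq0; apply/negP => /negP pq0.
pose x := cauchy_bound (p - q).
have := cauchy_boundP pq0 (x := x).
by rewrite hornerD hornerN h subrr => /(_ erefl); rewrite ltNge ler_norm.
Qed.

Lemma upoly_agree K s s' i t : (tbound t <= K)%N ->
  (forall j, (j < K)%N -> j != i -> s j = s' j) -> upoly s i t = upoly s' i t.
Proof.
move=> tK h; apply: poly_ext => x; rewrite !horner_upoly.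
by apply: (teval_agree tK) => j jK; rewrite /update; case: eqVneq => // /h->.
Qed.

(** A pair [(t, k)] stands for the root of rank [k] of [t] in the variable [i]. Candidates are put
    in register [i] until [f] holds; registers from [K] on are scratch. *)
Fixpoint search i K f (l : seq (tm rat * nat)) : program :=
  if l is (t, k) :: l' then
    PSeq (load K (qe_rcf.abstrX i t))
      (PSeq (PRoot i (iota K (size (qe_rcf.abstrX i t))) k)
            (branch f PSkip (search i K f l')))
  else PSkip.

Lemma exec_search i K f l s : (i < K)%N -> (fbound f <= K)%N ->
  all (fun tk => (tbound tk.1 <= K)%N) l ->
  all (fun tk => (sbound (qe_rcf.abstrX i tk.1) <= K)%N) l ->
  exists s', [/\ exec (search i K f l) s s',
    forall j, (j < K)%N -> j != i -> s' j = s j &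
    has (fun tk => fholds (update s i (rootsR (upoly s i tk.1))`_tk.2) f) l ->
    fholds s' f].
Proof.
move=> iK fK; elim: l s => [|[t k] l IH] s /=.
  by exists s; split=> //; apply: ExSkip.
move=> /andP[tK lK] /andP[aK alK].
have [s1 [e1 h1 m1]] := exec_load s aK (leqnn K).
pose s2 := update s1 i (rootsR (upoly s i t))`_k.
have e2 : exec (PRoot i (iota K (size (qe_rcf.abstrX i t))) k) s1 s2.
  by rewrite /s2 /upoly -m1; apply: ExRoot.
have h2 j : (j < K)%N -> s2 j = update s i (rootsR (upoly s i t))`_k j.
  by move=> jK; rewrite /s2 /update; case: eqP => // _; apply: h1.
have f2 := fholds_agree fK h2.
have [f2T|f2F] := boolP (fholds s2 f).
  exists s2; split=> //.
    apply: ExSeq e1 _; apply: ExSeq e2 _; apply: exec_branch.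
    by rewrite f2T; apply: ExSkip.
  by move=> j jK ji; rewrite h2 // /update (negPf ji).
have [s' [e' h' m']] := IH s2 lK alK.
have h3 j : (j < K)%N -> j != i -> s2 j = s j.
  by move=> jK ji; rewrite h2 // /update (negPf ji).
exists s'; split.
- apply: ExSeq e1 _; apply: ExSeq e2 _; apply: exec_branch.
  by rewrite (negPf f2F).
- by move=> j jK ji; rewrite h' // h3.
(* The remaining candidates are computed from [s2] instead of [s]; below [K] the two differ in
   register [i] only, on which the polynomials in the variable [i] do not depend. *)
- rewrite -f2 (negPf f2F) /= => hs; apply: m'; move: hs.
  elim: (l) lK => //= -[u m] l' IHl /andP[uK l'K] /orP[hs|/(IHl l'K)-> //].
    apply/orP; left; rewrite (upoly_agree uK h3); move: hs.
    rewrite (fholds_agree fK (s' := update s2 i (rootsR (upoly s i u))`_m)) //.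
    by move=> j jK; rewrite /update; case: eqVneq => // ji; rewrite h3.
  by rewrite orbT.
Qed.

Fixpoint atoms f : seq (tm rat) :=
  match f with
  | qe_rcf.Bool _ => [::]
  | qe_rcf.Equal t u | qe_rcf.Lt t u | qe_rcf.Le t u => [:: tsub t u]
  | qe_rcf.And f g | qe_rcf.Or f g | qe_rcf.Implies f g => atoms f ++ atoms g
  | qe_rcf.Not f => atoms f
  end.

Lemma fholds_sgr s s' f :
  all (fun t => Num.sg (teval s t) == Num.sg (teval s' t)) (atoms f) ->
  fholds s f = fholds s' f.
Proof.
elim: f => //=.
- by move=> t u; rewrite andbT => /eqP h;
    rewrite -[LHS]subr_eq0 -[RHS]subr_eq0 -sgr_eq0 h sgr_eq0.
- by move=> t u; rewrite andbT => /eqP h;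
    rewrite -[LHS]subr_lt0 -[RHS]subr_lt0 -sgr_lt0 h sgr_lt0.
- by move=> t u; rewrite andbT => /eqP h;
    rewrite -[LHS]subr_le0 -[RHS]subr_le0 -sgr_le0 h sgr_le0.
- by move=> f IHf g IHg; rewrite all_cat => /andP[/IHf-> /IHg->].
- by move=> f IHf g IHg; rewrite all_cat => /andP[/IHf-> /IHg->].
- by move=> f IHf g IHg; rewrite all_cat => /andP[/IHf-> /IHg->].
- by move=> f IHf /IHf->.
Qed.

Lemma sgr_horner_near (p : {poly R}) x : p.[x] != 0 ->
  exists2 e, 0 < e & forall y, `|y - x| < e -> Num.sg p.[y] = Num.sg p.[x].
Proof.
move=> px; have e0 : 0 < `|p.[x]| by rewrite normr_gt0.
have [d d0 h] := poly_cont x p e0; exists d => // y /h.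
case: (ltrgtP p.[x] 0) px => // px _.
  rewrite (ltr0_norm px) ltr_norml => /andP[_]; rewrite ltrBlDr addNr => py.
  by rewrite !ltr0_sg.
rewrite (gtr0_norm px) ltr_norml => /andP[+ _].
by rewrite ltrBrDr addNr => py; rewrite !gtr0_sg.
Qed.

Lemma all_sgr_near s i x l :
  all (fun t => (upoly s i t == 0) || ~~ root (upoly s i t) x) l ->
  exists2 e, 0 < e & forall y, `|y - x| < e ->
    all (fun t => Num.sg (teval (update s i y) t) ==
                  Num.sg (teval (update s i x) t)) l.
Proof.
elim: l => [_|t l IH] /=; first by exists 1.
move=> /andP[ht /IH[e e0 he]].
have [d d0 hd] : exists2 d, 0 < d & forall y, `|y - x| < d ->
    Num.sg (teval (update s i y) t) = Num.sg (teval (update s i x) t).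
  case/orP: ht => [/eqP p0|px].
    by exists 1 => // y _; rewrite -!horner_upoly p0 !horner0.
  have [d d0 hd] := sgr_horner_near px.
  by exists d => // y yx; rewrite -!horner_upoly hd.
exists (Num.min e d) => [|y]; first by rewrite lt_min e0.
by rewrite lt_min => /andP[/he-> /hd->]; rewrite eqxx.
Qed.

(** A point where no atom that is nonzero in the variable [i] vanishes is
    interior to the set defined by [f], hence does not belong to it if this
    set is finite. *)
Lemma finite_fholds_root s i f x (L : seq R) :
  (forall y, fholds (update s i y) f -> y \in L) -> fholds (update s i x) f ->
  has (fun t => (upoly s i t != 0) && root (upoly s i t) x) (atoms f).
Proof.
move=> hL hx; rewrite -[has _ _]negbK -all_predC; apply/negP => hall.
have {hall}/all_sgr_near[e e0 he] :
    all (fun t => (upoly s i t == 0) || ~~ root (upoly s i t) x) (atoms f).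
  by move: hall; elim: (atoms f) => //= t l IH /andP[+ /IH->];
    rewrite negb_and negbK => ->.
(* One point more than [L] has entries; the denominators start at 2 so that all of them lie at
   distance less than [e] from [x]. *)
pose ys := mkseq (fun k => x + e / k.+2%:R) (size L).+1.
have : (size ys <= size L)%N.
  apply: uniq_leq_size => [|y].
    apply/mkseq_uniqP => k l _ _ /addrI /(mulfI (lt0r_neq0 e0)) /invr_inj /eqP.
    by rewrite eqr_nat => /eqP [].
  case/mapP => k _ ->; apply: hL; rewrite (@fholds_sgr _ (update s i x)) //.
  apply: he; rewrite addrAC subrr add0r ger0_norm ?divr_ge0 ?ler0n ?ltW //.
  by rewrite ltr_pdivrMr ?ltr0Sn // ltr_pMr // ltr1n.
by rewrite size_mkseq ltnn.
Qed.

(** By finiteness, every solution is a root of an atom that is nonzero as a polynomial in the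
    variable [i]; trying all roots of all atoms therefore succeeds. *)
Lemma exec_select (S : store R -> Prop) i : definable S ->
  exists A, forall s (L : seq R), (forall x, S (update s i x) -> x \in L) ->
    (exists x, S (update s i x)) ->
    exists s', [/\ exec A s s', S s' & forall j, (j < i)%N -> s' j = s j].
Proof.
move=> [f hf].
(* Ranks below the length of the coefficient list suffice, since a nonzero polynomial has fewer
   roots than coefficients. *)
pose l := flatten [seq [seq (t, k) | k <- iota 0 (size (qe_rcf.abstrX i t))]
                  | t <- atoms f].
pose K := maxn (maxn i.+1 (fbound f))
  (maxn (foldr maxn 0%N [seq tbound tk.1 | tk <- l])
        (foldr maxn 0%N [seq sbound (qe_rcf.abstrX i tk.1) | tk <- l])).
have all_max (h : tm rat * nat -> nat) m :
    (foldr maxn 0%N (map h l) <= m)%N -> all (fun tk => (h tk <= m)%N) l.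
  by elim: (l) => //= tk l' IH; rewrite geq_max => /andP[-> /IH].
exists (search i K f l) => s L hL [x /hf hx].
have [] := @exec_search i K f l s.
- by rewrite /K !leq_max leqnn.
- by rewrite /K !leq_max leqnn !orbT.
- by apply: (all_max (fun tk => tbound tk.1)); rewrite /K !leq_max leqnn !orbT.
- apply: (all_max (fun tk => sbound (qe_rcf.abstrX i tk.1))).
  by rewrite /K !leq_max leqnn !orbT.
move=> s' [e' h' m']; exists s'; split=> //; last first.
  move=> j ji; apply: h'; last by rewrite ltn_eqF.
  by rewrite (ltn_trans ji) // /K !leq_max leqnn.
apply/hf/m'.
have hL' y : fholds (update s i y) f -> y \in L by move=> /hf/hL.
have := finite_fholds_root hL' hx.
rewrite /l; elim: (atoms f) => //= t ts IH /orP[/andP[p0 px]|/IH hts].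
  rewrite has_cat; apply/orP; left.
  have xr : x \in rootsR (upoly s i t).
    by rewrite -roots_on_rootsR // in_itv.
  rewrite has_map; apply/hasP; exists (index x (rootsR (upoly s i t))) => /=.
    rewrite mem_iota add0n /=; apply: leq_trans (_ : size (upoly s i t) <= _)%N.
      apply: leq_trans (_ : (size (rootsR (upoly s i t))).+1 <= _)%N.
        by rewrite ltnS ltnW // index_mem.
      apply: max_poly_roots => //; last exact: uniq_roots.
      by apply/allP => y; rewrite -roots_on_rootsR // => /andP[_].
    by rewrite (leq_trans (size_Poly _)) // size_map.
  by rewrite nth_index.
by rewrite has_cat hts orbT.
Qed.

End Programs.

(** * Computing a point of a finite fibre, one coordinate after the other *)

Section FiberProgram.
Variables (R : realType) (D off : nat) (Fib : store R -> 'rV[R]_D -> Prop).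
Implicit Types (s : store R) (x : 'rV[R]_D).

Definition stored_point s : 'rV[R]_D := \row_i s (off + i)%N.

Hypothesis Fib_agree : forall s s' x,
  (forall r, (r < off)%N -> s r = s' r) -> Fib s x -> Fib s' x.
Hypothesis Fib_definable : definable (fun s => Fib s (stored_point s)).

(** The invariant of the search: the first [j] coordinates already stored can be completed to a
    point of the fibre. *)
Definition prefix_extends j s : Prop :=
  exists2 x, Fib s x & forall i : 'I_D, (i < j)%N -> x 0 i = s (off + i)%N.

Lemma prefix_extendsD s : prefix_extends D s <-> Fib s (stored_point s).
Proof.
split=> [[x hx xs]|h]; last by exists (stored_point s) => // i _; rewrite mxE.
suff -> : stored_point s = x by [].
by apply/rowP => i; rewrite mxE xs.
Qed.

(** The fibre depends only on registers below [off], so it does not change when a coordinate is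
    overwritten. *)
Lemma prefix_extendsS j s : (j < D)%N ->
  (exists y, prefix_extends j.+1 (update s (off + j) y)) <->
  prefix_extends j s.
Proof.
move=> jD; have low y r : (r < off)%N -> update s (off + j) y r = s r.
  by move=> ro; rewrite /update ltn_eqF // (leq_trans ro) // leq_addr.
split=> [[y [x hx xs]]|[x hx xs]].
  exists x; first by apply: Fib_agree hx => r; apply: low.
  by move=> i ij; rewrite xs ?leqW // /update eqn_add2l ltn_eqF.
exists (x 0 (Ordinal jD)); exists x.
  by apply: Fib_agree hx => r ro; rewrite low.
move=> i; rewrite ltnS leq_eqVlt /update eqn_add2l => /predU1P[ij|ij].
  by rewrite ij eqxx; congr (x _ _); apply: val_inj.
by rewrite (ltn_eqF ij) xs.
Qed.

Lemma definable_prefix_extends j : (j <= D)%N -> definable (prefix_extends j).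
Proof.
(* Descending induction: with all [D] coordinates given this is membership in the fibre, and each
   step down eliminates one variable. *)
move=> jD; rewrite -(subKn jD); move: (D - j)%N (leq_subr j D) => k.
elim: k => [_|k IH kD].
  by rewrite subn0; apply: definable_iff Fib_definable => s;
    rewrite prefix_extendsD.
have jD' : (D - k.+1 < D)%N by rewrite ltn_subrL (leq_trans _ kD).
have [f hf] := definable_ex (off + (D - k.+1))%N (IH (ltnW kD)).
exists f => s; rewrite -hf -(prefix_extendsS _ jD') subnSK //.
Qed.

Lemma exec_fiber_point : exists A, forall s (L : seq 'rV[R]_D),
  (forall x, Fib s x -> x \in L) -> (exists x, Fib s x) ->
  exists s', [/\ exec A s s', Fib s' (stored_point s')
    & forall r, (r < off)%N -> s' r = s r].
Proof.
suff hj j : (j <= D)%N -> exists A, forall s (L : seq 'rV[R]_D),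
    (forall x, Fib s x -> x \in L) -> (exists x, Fib s x) ->
    exists s', [/\ exec A s s', prefix_extends j s'
      & forall r, (r < off)%N -> s' r = s r].
  have [A hA] := hj D (leqnn D).
  exists A => s L hL hx; have [s' [e /prefix_extendsD h hr]] := hA s L hL hx.
  by exists s'.
elim: j => [_|j IH jD].
  exists PSkip => s L _ [x hx]; exists s.
  by split; [exact: ExSkip|exists x|].
have [A hA] := IH (ltnW jD).
have [B hB] := exec_select (off + j) (definable_prefix_extends jD).
exists (PSeq A B) => s L hL hx.
have [s1 [e1 h1 r1]] := hA s L hL hx.
(* The possible values of the next coordinate are among those of the finitely many points of the
   fibre. *)
have [] := hB s1 [seq x 0 (Ordinal jD) | x : 'rV[R]_D <- L].
- move=> y [x hx' xs]; apply/mapP; exists x.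
    apply: hL; apply: Fib_agree hx' => r ro.
    by rewrite /update ltn_eqF ?r1 // (leq_trans ro) // leq_addr.
  by rewrite xs // /update eqxx.
- by apply/prefix_extendsS.
move=> s2 [e2 h2 r2]; exists s2; split=> //; first exact: ExSeq e1 e2.
by move=> r ro; rewrite r2 ?r1 // (leq_trans ro) // leq_addr.
Qed.

Fixpoint copy_point m : program :=
  if m is m'.+1 then PSeq (copy_point m') (PAssign m (EVar (off + m')))
  else PSkip.

(** The registers 1 to [m] written and those from [off] on that are read are disjoint because
    [m < off]. *)
Lemma exec_copy_point m s : (m < off)%N ->
  exists s', [/\ exec (copy_point m) s s',
    forall i, (i < m)%N -> s' i.+1 = s (off + i)%N
    & forall r, (off <= r)%N -> s' r = s r].
Proof.
elim: m => [_|m IH mo] /=; first by exists s; split=> //; apply: ExSkip.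
have [s1 [e1 h1 r1]] := IH (ltnW mo).
exists (update s1 m.+1 (s1 (off + m)%N)); split.
- by apply: ExSeq e1 _; apply: (@ExAssign _ _ (EVar _)).
- move=> i; rewrite ltnS leq_eqVlt /update eqSS => /predU1P[->|im].
    by rewrite eqxx r1 // leq_addr.
  by rewrite (ltn_eqF im) h1.
- by move=> r ro; rewrite /update gtn_eqF ?r1 // (leq_trans mo).
Qed.

(** Nonemptiness of the fibre is tested first, by eliminating all coordinates; only if it fails is
    [S] consulted. Finiteness of the fibre ensures that the search ends at one of its points. *)
Lemma decision_program (S : store R -> Prop) : (D < off)%N -> definable S ->
  exists A, forall s, (exists L : seq 'rV[R]_D, forall x, Fib s x -> x \in L) ->
  exists s', [/\ exec A s s',
    (exists x, Fib s x) -> answers s' IsHMP /\ Fib s (output_point D s'),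
    ~ (exists x, Fib s x) -> S s -> answers s' CannotDecide
    & ~ (exists x, Fib s x) -> ~ S s -> answers s' NoHMP].
Proof.
move=> Doff [g hg]; have [f hf] := definable_prefix_extends (leq0n D).
have hf' s : fholds s f <-> exists x, Fib s x.
  by rewrite -hf; split=> [[x]|[x hx]]; exists x.
have [A hA] := exec_fiber_point.
have asg k (s : store R) : exec (PAssign 0 (ECst k%:R)) s (update s 0 k%:R).
  rewrite -[in X in exec _ _ X](_ : Defs.eval s (ECst k%:R) = k%:R).
    exact: ExAssign.
  by rewrite /= rmorph_nat.
exists (branch f (PSeq A (PSeq (copy_point D) (PAssign 0 (ECst 1%:R))))
  (branch g (PAssign 0 (ECst 2%:R)) (PAssign 0 (ECst 0%:R)))) => s [L hL].
have [fT|fF] := boolP (fholds s f).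
  have hx := (hf' s).1 fT.
  have [s1 [e1 h1 r1]] := hA s L hL hx.
  have [s2 [e2 h2 r2]] := exec_copy_point s1 Doff.
  exists (update s2 0 1%:R); split=> // [|_].
    apply: exec_branch; rewrite fT.
    by apply: ExSeq e1 _; apply: ExSeq e2 _; apply: asg.
  split=> //; suff -> : output_point D (update s2 0 1%:R) = stored_point s1.
    exact: Fib_agree h1.
  by apply/rowP => i; rewrite !mxE /update /= h2.
have [gT|gF] := boolP (fholds s g).
  exists (update s 0 2%:R); split=> //.
  - by apply: exec_branch; rewrite (negPf fF); apply: exec_branch; rewrite gT.
  - by move/hf'; rewrite (negPf fF).
  - by move=> _ /hg.
exists (update s 0 0%:R); split=> //.
- by apply: exec_branch; rewrite (negPf fF); apply: exec_branch;
    rewrite (negPf gF).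
- by move/hf'; rewrite (negPf fF).
- by move=> _ /hg; rewrite (negPf gF).
Qed.

End FiberProgram.

(** * Dimension of a hypersurface *)

Section Dimension.
Variables (R : realType) (D : nat).
Implicit Types (p q f g h : {mpoly R[D]}) (J : {mpoly R[D]} -> Prop)
  (V W N : set 'rV[R]_D).

Definition vanishes V p : Prop := forall x, V x -> p.@[x 0] = 0.

Definition free_mod J (I : finType) (b : I -> {mpoly R[D]}) : Prop :=
  forall c : I -> R, J (\sum_i c i *: b i) -> forall i, c i = 0.

(** A relation modulo [J] is read as a polynomial in [f]. Its constant term lies in [J'], so the
    coefficients there vanish; then [f] is cancelled modulo [J], and the number of powers has
    dropped by one. *)
Lemma free_mod_powers J J' f (I : finType) (b : I -> {mpoly R[D]}) K :
  (forall g h, J (g + f * h) -> J' g) -> (forall g, J (f * g) -> J g) ->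
  free_mod J' b ->
  free_mod J (fun ik : I * 'I_K => b ik.1 * f ^+ ik.2).
Proof.
move=> hJJ' hJ hb c.
have -> : \sum_ik c ik *: (b ik.1 * f ^+ ik.2) =
    \sum_(k < K) (\sum_i c (i, k) *: b i) * f ^+ k.
  rewrite (eq_bigr (fun ik => c (ik.1, ik.2) *: (b ik.1 * f ^+ ik.2)));
    last by case.
  rewrite -(pair_bigA _ (fun i k => c (i, k) *: (b i * f ^+ k))) exchange_big.
  by apply: eq_bigr => k _; rewrite mulr_suml; apply: eq_bigr => i _;
    rewrite scalerAl.
move=> hs; suff hc k i : c (i, k) = 0 by case=> i k; apply: hc.
elim: K c hs k i => [c _ []//|K IH c hs].
have c0 : forall i, c (i, ord0) = 0.
  apply: hb; apply: (hJJ' _ (\sum_(k < K)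
    (\sum_i c (i, lift ord0 k) *: b i) * f ^+ k)).
  move: hs; rewrite big_ord_recl expr0 mulr1 mulr_sumr.
  congr (J (_ + _)); apply: eq_bigr => k _.
  by rewrite exprS mulrCA.
move=> k; have [k' ->|->] := unliftP ord0 k; last exact: c0.
apply: (IH (fun ik => c (ik.1, lift ord0 ik.2))).
apply: hJ; move: hs; rewrite big_ord_recl big1 => [|j _]; last first.
  by rewrite c0 scale0r.
rewrite mul0r add0r mulr_sumr; congr J; apply: eq_bigr => j _.
by rewrite exprS mulrCA.
Qed.

(** Only monomials with all exponents below [L] occur, and there are [L ^ D] of them; the
    coefficient matrix has independent rows. *)
Lemma leq_card_free_mod0 (I : finType) (b : I -> {mpoly R[D]}) L :
  free_mod (fun p => p = 0) b -> (forall i, (msize (b i) <= L)%N) ->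
  (#|I| <= L ^ D)%N.
Proof.
move=> hb hL; pose T : finType := {ffun 'I_D -> 'I_L}.
have cT : #|T| = (L ^ D)%N by rewrite card_ffun !card_ord.
pose mon (u : T) : 'X_{1..D} := [multinom u i : nat | i < D].
pose A : 'M[R]_(#|I|, #|T|) :=
  \matrix_(i, u) (b (enum_val i))@_(mon (enum_val u)).
rewrite -cT; suff : row_free A by move/eqP<-; apply: rank_leq_col.
apply: inj_row_free => v vA; apply/rowP => j; rewrite mxE.
pose c (i : I) := v 0 (enum_rank i).
suff : c (enum_val j) = 0 by rewrite /c enum_valK.
apply: hb; apply/mpolyP => m; rewrite mcoeff0 raddf_sum /=.
have [mL|mL] := boolP [forall i, (m i < L)%N]; last first.
  rewrite big1 // => i _; rewrite mcoeffZ memN_msupp_eq0 ?mulr0 //.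
  apply: msize_mdeg_ge; apply: leq_trans (hL i) _.
  move: mL; rewrite negb_forall => /existsP[k]; rewrite -leqNgt => mk.
  by apply: leq_trans mk _; rewrite mdegE (bigD1 k) //= leq_addr.
move/forallP: mL => mL; pose u : T := [ffun i => Ordinal (mL i)].
have mu : mon u = m by apply/mnmP => i; rewrite mnmE ffunE.
move/matrixP: vA => /(_ 0 (enum_rank u)); rewrite !mxE => vA.
rewrite -{}[RHS]vA (reindex_onto enum_val enum_rank) => [|i _]; last first.
  exact: enum_rankK.
apply: eq_big => i; rewrite ?enum_valK ?eqxx //= => _.
by rewrite mcoeffZ mxE /c enum_valK enum_rankK mu.
Qed.

(** Only the linear growth in [K] matters to the dimension count; the constants are generous. *)
Lemma msize_mul_expr p f e K k : (k < K)%N -> (msize p <= e * K + 1)%N ->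
  (msize (p * f ^+ k) <= (e + msize f + 3) * K + 1)%N.
Proof.
have hf j : (msize (f ^+ j) <= j * (msize f + 1) + 1)%N.
  elim: j => [|j IH]; first by rewrite expr0 msize1.
  by rewrite exprS (leq_trans (msizeM_le _ _)) //; lia.
move=> kK hp; apply: leq_trans (msizeM_le _ _) _.
have := hf k; have : (k * (msize f + 1) <= K.-1 * (msize f + 1))%N.
  by rewrite leq_mul2r; lia.
by case: K kK hp => // K _ hp /=; lia.
Qed.

(** Otherwise [W] would be the union of two proper algebraic subsets, the zeros of [f] and of [g] in
    it. *)
Lemma irreducible_prime W f g : irreducible W -> vanishes W (f * g) ->
  vanishes W f \/ vanishes W g.
Proof.
move=> [[I WI] _ hW] fg.
pose Z p := [set x | W x /\ p.@[x 0] = 0].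
have aZ p : algebraic (Z p).
  exists [set r | I r \/ r = p].
  apply/seteqP; split=> [x [Wx px] r [|->//]|x hx].
    by move: Wx; rewrite WI => h /h.
  by split; [rewrite WI => r Ir; apply: hx; left|apply: hx; right].
have [] := hW _ _ (aZ f) (aZ g).
- apply/seteqP; split=> [x Wx|x [] []//].
  have /eqP := fg x Wx; rewrite mevalM mulf_eq0.
  by case/orP => /eqP h; [left|right].
- by move=> WZ; left => x; rewrite WZ => -[].
- by move=> WZ; right => x; rewrite WZ => -[].
Qed.

Lemma algebraic_separate V W : algebraic V -> V `<` W ->
  exists2 f, vanishes V f & ~ vanishes W f.
Proof.
move=> [I VI] [VW WV]; apply: contrapT => hn; apply: WV => x Wx.
rewrite VI => p Ip; apply: contrapT => px; apply: hn; exists p.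
  by move=> y; rewrite VI => /(_ p Ip).
by move=> /(_ x Wx).
Qed.

(** The [m] successive functions separating the members of the chain are
    algebraically independent on its last member. *)
Lemma chain_free_mod N C m : irreducible_chain N C m ->
  exists e, forall K, exists (I : finType) (b : I -> {mpoly R[D]}),
    [/\ #|I| = (K ^ m)%N, free_mod (vanishes (C m)) b
      & forall i, (msize (b i) <= e * K + 1)%N].
Proof.
move=> [hC hS]; elim: m hC hS => [|m IH] hC hS.
  exists 0%N => K; exists unit, (fun=> 1); split; first by rewrite card_unit.
    move=> c; have [[_ [x Cx] _] _] := hC 0%N isT.
    rewrite (big_pred1 tt) => [|[]] // /(_ x Cx).
    by rewrite mevalZ meval1 mulr1 => h [].
  by move=> _; rewrite msize1.
have [] := IH _ _; first by move=> i im; apply: hC; rewrite leqW.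
  by move=> i im; apply: hS; rewrite leqW.
move=> e he.
have [[aV _ _] _] := hC m (leqnSn _).
have [irrW _] := hC m.+1 (leqnn _).
have [f fV fW] := algebraic_separate aV (hS m (leqnn _)).
exists (e + msize f + 3)%N => K; have [I [b [cI bI sI]]] := he K.
exists (I * 'I_K)%type, (fun ik : I * 'I_K => b ik.1 * f ^+ ik.2); split.
- by rewrite card_prod cI card_ord expnSr.
- apply: (@free_mod_powers _ (vanishes (C m))) => // [g h gh x Vx|g].
    have [VW _] := hS m (leqnn _).
    by have := gh x (VW x Vx); rewrite mevalD mevalM fV // mul0r addr0.
  by case/(irreducible_prime irrW).
by case=> i k; apply: msize_mul_expr.
Qed.

(** Powers of [q] adjoined to the functions separating a chain of length [m] give [K ^ m.+1]
    independent polynomials of size at most [E * K], hence [K ^ m.+1 <= (E * K) ^ D]. If [D <= m],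
    this fails as soon as [K] exceeds [E ^ D]. *)
Lemma dim_lt_hypersurface q : q != 0 -> dim_lt [set x | q.@[x 0] = 0] D.
Proof.
move=> q0 C m hC; have [e he] := chain_free_mod hC.
pose E := (e + msize q + 4)%N; pose K := (E ^ D).+1.
have [I [b [cI bI sI]]] := he K.
rewrite ltnNge; apply/negP => Dm.
have := @leq_card_free_mod0 (I * 'I_K)%type
  (fun ik : I * 'I_K => b ik.1 * q ^+ ik.2) (E * K)%N.
rewrite card_prod cI card_ord -expnSr leqNgt => /(_ _ _)/negP; apply.
(* Independence is now modulo the zero ideal: [q] vanishes on the last member of the chain, which
   lies in the hypersurface, and is cancelled because polynomials form a domain. *)
- apply: (@free_mod_powers _ (vanishes (C m))) => // [g h /eqP|g /eqP].
    rewrite addr_eq0 => /eqP-> x Cx; rewrite mevalN mevalM.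
    by have [_ /(_ x Cx)->] := hC.1 m (leqnn m); rewrite mul0r oppr0.
  by rewrite mulf_eq0 (negPf q0) => /eqP.
- case=> i k /=; apply: leq_trans (msize_mul_expr q (ltn_ord k) (sI i)) _.
  by rewrite /E /K; lia.
rewrite expnMn; apply: leq_ltn_trans (_ : E ^ D * K ^ m < _)%N.
  by rewrite leq_mul2l leq_pexp2l ?orbT.
by rewrite expnS ltn_mul2r expn_gt0 /= ltnSn.
Qed.

End Dimension.

(** * Identification of the hidden states *)

Section Rigidity.
Variables (R : realType) (d : nat).
Implicit Types (T M S : 'M[R]_d.+1) (p e : 'cV[R]_d.+1).

Notation one := (const_mx 1 : 'cV[R]_d.+1).

(** The controllability and observability matrices of the linear system; their product is the Hankel
    matrix with entries [p^T T^(i+j) 1]. *)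
Definition ctrl_mx p T : 'M[R]_d.+1 :=
  \matrix_(i, j) (p^T *m T ^+ i) 0 j.
Definition obs_mx T : 'M[R]_d.+1 := \matrix_(i, j) (T ^+ j *m one) i 0.

Lemma ctrl_mul_obs p T A i j : (ctrl_mx p T *m A *m obs_mx T) i j =
  (p^T *m (T ^+ i *m A *m T ^+ j) *m one) 0 0.
Proof.
have r : row i (ctrl_mx p T) = p^T *m T ^+ i by apply/rowP => k; rewrite !mxE.
have c : col j (obs_mx T) = T ^+ j *m one by apply/colP => k; rewrite !mxE.
transitivity ((row i (ctrl_mx p T) *m A *m col j (obs_mx T)) 0 0).
  by rewrite -row_mul colE mulmxA -row_mul -colE [RHS]mxE [RHS]mxE.
by rewrite r c !mulmxA.
Qed.

Lemma mulmx_delta_obs T : obs_mx T *m delta_mx 0 0 = one.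
Proof.
by rewrite -colE; apply/colP => i; rewrite 2![LHS]mxE expr0 -idmxE mul1mx.
Qed.

Lemma delta_mul_ctrl p T : delta_mx 0 0 *m ctrl_mx p T = p^T.
Proof.
by rewrite -rowE; apply/rowP => i; rewrite 2![LHS]mxE expr0 -idmxE mulmx1.
Qed.

(** With [U], [V] the control and observation matrices, [U V = U' V'] is invertible, so
    [S = V' V^-1] also equals [U'^-1 U]; cancelling [U'] and [V] turns equal data [U A V] into
    [S A = A' S]. *)
Lemma realization_similar p p' T T' M M' :
  ctrl_mx p T *m obs_mx T \in unitmx ->
  ctrl_mx p T *m obs_mx T = ctrl_mx p' T' *m obs_mx T' ->
  ctrl_mx p T *m T *m obs_mx T = ctrl_mx p' T' *m T' *m obs_mx T' ->
  ctrl_mx p T *m M *m obs_mx T = ctrl_mx p' T' *m M' *m obs_mx T' ->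
  exists2 S, S \in unitmx &
    [/\ S *m T = T' *m S, S *m M = M' *m S, S *m one = one & p'^T *m S = p^T].
Proof.
set U := ctrl_mx p T; set V := obs_mx T.
set U' := ctrl_mx p' T'; set V' := obs_mx T'.
move=> uUV eUV eT eM; have uUV' : U' *m V' \in unitmx by rewrite -eUV.
move: (uUV) (uUV'); rewrite !unitmx_mul => /andP[uU uV] /andP[uU' uV'].
have eS : U' *m V' *m invmx V = U by rewrite -eUV mulmxK.
have inter A A' : U *m A *m V = U' *m A' *m V' ->
    V' *m invmx V *m A = A' *m (V' *m invmx V).
  move=> h; apply: (can_inj (mulKmx uU')).
  by rewrite !mulmxA eS -h mulmxK.
exists (V' *m invmx V); first by rewrite unitmx_mul uV' unitmx_inv.
split; [exact: inter|exact: inter| |].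
  by rewrite -{1}(mulmx_delta_obs T) mulmxA mulmxKV // mulmx_delta_obs.
by rewrite -(delta_mul_ctrl p' T') -/U' -mulmxA (mulmxA U') eS delta_mul_ctrl.
Qed.

(** A nonzero entry of [S] at [(s, t)] forces [e'_s = e_t]. As the [e_t] are distinct, each row has
    at most one nonzero entry, which is 1 since [S] fixes the vector of ones. *)
Lemma intertwiner_perm S (e e' : 'rV[R]_d.+1) :
  S \in unitmx -> S *m one = one -> injective (e 0) ->
  S *m diag_mx e = diag_mx e' *m S ->
  exists2 g : 'S_d.+1, S = perm_mx g & forall s, e' 0 s = e 0 (g s).
Proof.
move=> uS S1 ie hS.
have ent s t : S s t != 0 -> e' 0 s = e 0 t.
  move=> st; move/matrixP: hS => /(_ s t).
  by rewrite mul_mx_diag mul_diag_mx !mxE mulrC => /(mulIf st).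
(* An invertible matrix has no zero column. *)
have ex t : exists s, S s t != 0.
  apply/existsP; apply: contraT; rewrite negb_exists => /forallP h.
  have : col t S = 0.
    apply/colP => s; rewrite !mxE; apply/eqP.
    by rewrite -[_ == _]negbK; apply: h.
  rewrite colE => /(congr1 (mulmx (invmx S))); rewrite mulKmx // mulmx0.
  by move/colP/(_ t)/eqP; rewrite !mxE !eqxx oner_eq0.
pose f t := xchoose (ex t).
have ef t : e' 0 (f t) = e 0 t by apply: ent (xchooseP (ex t)).
have fI : injective f by move=> t t' /(congr1 (e' 0)); rewrite !ef => /ie.
pose g := (perm fI)^-1%g.
have gf s : e' 0 s = e 0 (g s) by rewrite -ef -{1}(permKV (perm fI) s) permE.
exists g => //; apply/matrixP => s t; rewrite !mxE.
have off t' : t' != g s -> S s t' = 0.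
  by move=> tg; apply/eqP; apply: contraNT tg => /ent; rewrite gf => /ie ->.
have [<-|tg] := eqVneq (g s) t; last by rewrite off ?(negPf tg) // eq_sym.
move/colP: S1 => /(_ s); rewrite !mxE (bigD1 (g s)) //= big1 => [|t' ht'].
  by rewrite addr0 mxE mulr1.
by rewrite off // mul0r.
Qed.

(** Minimal realizations with the same Hankel data are similar, and the
    similarity, which diagonalizes [T M^-1], permutes the states. *)
Lemma realization_perm p p' M M' (e e' : 'rV[R]_d.+1) :
  let T := diag_mx e *m M in let T' := diag_mx e' *m M' in
  ctrl_mx p T *m obs_mx T \in unitmx -> M \in unitmx -> injective (e 0) ->
  ctrl_mx p T *m obs_mx T = ctrl_mx p' T' *m obs_mx T' ->
  ctrl_mx p T *m T *m obs_mx T = ctrl_mx p' T' *m T' *m obs_mx T' ->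
  ctrl_mx p T *m M *m obs_mx T = ctrl_mx p' T' *m M' *m obs_mx T' ->
  exists g : 'S_d.+1, [/\ M' = row_perm g (col_perm g M),
    p' = row_perm g p & forall s, e' 0 s = e 0 (g s)].
Proof.
move=> T T' uH uM ie eH eT eM.
have [S uS [ST SM S1 pS]] := realization_similar uH eH eT eM.
have Se : S *m diag_mx e = diag_mx e' *m S.
  (* Multiplied by the invertible [M], both sides become [S T = T' S]. *)
  apply: (can_inj (mulmxK uM)).
  by rewrite -mulmxA ST /T' -!mulmxA SM.
have [g Sg eg] := intertwiner_perm uS S1 ie Se.
exists g; split=> //.
  by rewrite row_permE col_permE perm_mxV -Sg mulmxA SM mulmxK.
rewrite row_permE -Sg; apply: trmx_inj; rewrite trmx_mul -pS Sg tr_perm_mx.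
by rewrite perm_mxV mulmxK // unitmx_perm.
Qed.

End Rigidity.

(** * Free coordinates of triples with unit sums *)

Section CompleteSum.
Variable R : realType.

Lemma complete_sum1_widen m (v : 'I_m.-1 -> R) j :
  complete_sum1 v (widen_ord (leq_pred m) j) = v j.
Proof.
rewrite /complete_sum1; case: insubP => [j' _ jj'|]; last by rewrite /= ltn_ord.
by congr v; apply: val_inj.
Qed.

Lemma complete_sum1_max m (v : 'I_m -> R) :
  @complete_sum1 R m.+1 v ord_max = 1 - \sum_k v k.
Proof. by rewrite /complete_sum1; case: insubP => [j'|] //=; rewrite ltnn. Qed.

Lemma sum_complete_sum1 m (v : 'I_m.-1 -> R) : (0 < m)%N ->
  \sum_j complete_sum1 v j = 1.
Proof.
case: m v => // m v _; rewrite big_ord_recr /= complete_sum1_max.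
rewrite (eq_bigr v) => [|j _]; first by rewrite addrC subrK.
rewrite -[RHS](@complete_sum1_widen m.+1); congr complete_sum1.
exact: val_inj.
Qed.

Lemma complete_sum1_restrict m (w : 'I_m -> R) : \sum_j w j = 1 ->
  complete_sum1 (fun j => w (widen_ord (leq_pred m) j)) =1 w.
Proof.
case: m w => [w _ []//|m w w1 j]; have [jm|mj] := ltnP j m.
  have -> : j = widen_ord (leq_pred m.+1) (Ordinal jm) by apply: val_inj.
  exact: complete_sum1_widen.
have -> : j = ord_max.
  by apply: val_inj => /=; apply/eqP; rewrite eqn_leq mj -ltnS ltn_ord.
rewrite complete_sum1_max -w1 big_ord_recr /=.
rewrite [X in _ - X](eq_bigr (fun k => w (widen_ord (leqnSn m) k))).
  by rewrite addrAC subrr add0r.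
by move=> k _; congr w; apply: val_inj.
Qed.

End CompleteSum.

Section Coordinates.
Variables (R : realType) (Sigma : finType) (d : nat).
Implicit Types (t : hmp_triple R Sigma d).

(** Signs are left out: the word function and the singular locus live on all of the parameter
    space. *)
Definition unit_sums t : Prop :=
  [/\ forall i, \sum_j trans t i j = 1, forall s, \sum_b emis t s b = 1
    & \sum_s init t s 0 = 1].

Definition coords_of t : 'rV[R]_(param_dim d #|Sigma|) :=
  row_mx (row_mx
    (mxvec (\matrix_(i < d, j < d.-1) trans t i (widen_ord (leq_pred d) j)))
    (mxvec (\matrix_(s < d, b < #|Sigma|.-1)
      emis t s (widen_ord (leq_pred #|Sigma|) b))))
    (\row_s init t (widen_ord (leq_pred d) s) 0).

Lemma triple_ofK : cancel (@triple_of R Sigma d) coords_of.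
Proof.
move=> x; rewrite -[RHS]hsubmxK -[lsubmx x in RHS]hsubmxK.
rewrite -[lsubmx (lsubmx x) in RHS]vec_mxK -[rsubmx (lsubmx x) in RHS]vec_mxK.
rewrite /coords_of; congr (row_mx (row_mx (mxvec _) (mxvec _)) _).
- by apply/matrixP => i j; rewrite !mxE complete_sum1_widen !mxE.
- by apply/matrixP => i j; rewrite !mxE complete_sum1_widen !mxE.
- by apply/rowP => j; rewrite !mxE complete_sum1_widen !mxE.
Qed.

Lemma coords_ofK t : unit_sums t -> triple_of (coords_of t) = t.
Proof.
case: t => M E p [/= hM hE hp]; rewrite /triple_of /coords_of.
rewrite !(row_mxKl, row_mxKr) !mxvecK /=; congr HmpTriple.
- apply/matrixP => i j; rewrite mxE -[RHS](complete_sum1_restrict (hM i)).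
  rewrite /complete_sum1; case: insub => [k|]; first by rewrite mxE.
  by congr (_ - _); apply: eq_bigr => k _; rewrite mxE.
- apply/matrixP => i j; rewrite mxE -[RHS](complete_sum1_restrict (hE i)).
  rewrite /complete_sum1; case: insub => [k|]; first by rewrite mxE.
  by congr (_ - _); apply: eq_bigr => k _; rewrite mxE.
- apply/colP => j.
  rewrite mxE -[RHS](@complete_sum1_restrict _ _ (fun s => p s 0)) //.
  rewrite /complete_sum1; case: insub => [k|]; first by rewrite mxE.
  by congr (_ - _); apply: eq_bigr => k _; rewrite mxE.
Qed.

Lemma unit_sums_triple_of x : (0 < d)%N -> (0 < #|Sigma|)%N ->
  unit_sums (@triple_of R Sigma d x).
Proof.
move=> d0 s0; split=> [i|s|].
- by under eq_bigr do rewrite mxE; apply: sum_complete_sum1.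
- by under eq_bigr do rewrite mxE; apply: sum_complete_sum1.
- by under eq_bigr do rewrite mxE; apply: sum_complete_sum1.
Qed.

End Coordinates.

Lemma two_terms_sum (V : zmodType) m (w : 'I_m -> V) c i j : m = 2%N ->
  \sum_k w k = c -> j != i -> w j + w i = c.
Proof.
move=> m2 <- ji; rewrite (bigD1 i) //= (bigD1 j) //=.
rewrite big_pred0 ?addr0 1?addrC // => k.
move: i j k ji {w}; rewrite m2.
by do 3![case=> [[|[|//]] ?]]; rewrite -!val_eqE.
Qed.

(** * Word functions, their marginals, and the singular locus *)

Section Identifiability.
Variables (R : realType) (Sigma : finType) (d : nat) (a0 : Sigma).
Implicit Types (t : hmp_triple R Sigma d.+1) (a : Sigma) (v : seq Sigma).

Notation one := (const_mx 1 : 'cV[R]_d.+1).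

Definition word_val t v : R := ((init t)^T *m word_mx t v *m one) 0 0.

Lemma word_mx_cat t v w : word_mx t (v ++ w) = word_mx t v *m word_mx t w.
Proof.
elim: v => [|a v IH]; first by rewrite /word_mx big_nil mul1mx.
by move: IH; rewrite /word_mx /= !big_cons => ->; rewrite mulmxA.
Qed.

Lemma word_mx1 t a : word_mx t [:: a] = letter_mx t a.
Proof. by rewrite /word_mx big_cons big_nil mulmx1. Qed.

Lemma word_mx_nseq t k a : word_mx t (nseq k a) = letter_mx t a ^+ k.
Proof.
elim: k => [|k IH]; first by rewrite /word_mx big_nil.
rewrite -[nseq k.+1 a]/([:: a] ++ nseq k a) word_mx_cat word_mx1 IH.
by rewrite exprS.
Qed.

Lemma sum_emis_diag t : unit_sums t -> \sum_a emis_diag t a = 1%:M.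
Proof.
move=> [_ hE _]; apply/matrixP => i j; rewrite summxE !mxE.
rewrite (reindex_onto enum_val enum_rank) => [|a _]; last exact: enum_rankK.
rewrite (eq_bigr (fun b => emis t i b *+ (i == j))) => [|b _].
  rewrite sumrMnl; under eq_bigl do rewrite enum_valK eqxx.
  by rewrite hE; case: (i == j).
by rewrite !mxE enum_valK; case: eqP => [->|].
Qed.

Lemma sum_letter_mx t : unit_sums t -> \sum_a letter_mx t a = trans t.
Proof. by move=> ht; rewrite -mulmx_suml sum_emis_diag // mul1mx. Qed.

Lemma trans_one t : unit_sums t -> trans t *m one = one.
Proof.
move=> [hM _ _]; apply/colP => i; rewrite !mxE -[RHS](hM i).
by apply: eq_bigr => j _; rewrite mxE mulr1.
Qed.

(** The matrices [O_a] sum to the identity, so summing over a letter puts [M] in its place. *)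
Lemma sum_word_val_cat t v w : unit_sums t ->
  \sum_a word_val t (v ++ a :: w) =
  ((init t)^T *m (word_mx t v *m trans t *m word_mx t w) *m one) 0 0.
Proof.
move=> ht; rewrite /word_val -summxE -mulmx_suml -mulmx_sumr.
congr ((_ *m _ *m _) 0 0).
rewrite -(sum_letter_mx ht) mulmx_sumr mulmx_suml; apply: eq_bigr => a _.
by rewrite -cat1s !word_mx_cat word_mx1 mulmxA.
Qed.

Lemma sum_word_val_rcons t v : unit_sums t ->
  \sum_a word_val t (rcons v a) = word_val t v.
Proof.
move=> ht; under eq_bigr do rewrite -cats1.
rewrite sum_word_val_cat // /word_mx big_nil mulmx1.
by rewrite -!mulmxA trans_one // !mulmxA.
Qed.

(** The last letter can be summed out because [M] fixes the vector of ones, so length [n] determines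
    all shorter lengths. *)
Lemma word_val_shorter n t t' : unit_sums t -> unit_sums t' ->
  (forall v, size v = n -> word_val t v = word_val t' v) ->
  forall v, (size v <= n)%N -> word_val t v = word_val t' v.
Proof.
move=> ht ht'; elim: n => [|n IH] h v.
  by rewrite leqn0 => /eqP; apply: h.
rewrite leq_eqVlt => /predU1P[/h //|]; rewrite ltnS; apply: IH => w wn.
rewrite -!(sum_word_val_rcons w) //; apply: eq_bigr => a _.
by apply: h; rewrite size_rcons wn.
Qed.

Definition hankel_mx t : 'M[R]_d.+1 :=
  ctrl_mx (init t) (letter_mx t a0) *m obs_mx (letter_mx t a0).

Definition emis0 t : 'rV[R]_d.+1 := \row_s emis t s (enum_rank a0).

Definition identifiable t : Prop :=
  [/\ hankel_mx t \in unitmx, trans t \in unitmx & injective (emis0 t 0)].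

Definition singularity t : R :=
  \det (hankel_mx t) * \det (trans t) *
  \prod_s \prod_(s' | s' != s) (emis0 t 0 s - emis0 t 0 s').

Lemma singularityP t : reflect (identifiable t) (singularity t != 0).
Proof.
rewrite /singularity !mulf_eq0 !negb_or -!unitfE -!unitmxE -andbA.
apply: (iffP and3P) => -[h1 h2 h3]; split=> //.
  move=> s s' ss'; apply/eqP; apply: contraTT h3 => nss'; rewrite unitfE negbK.
  apply/prodf_eq0; exists s => //; apply/prodf_eq0.
  by exists s'; rewrite ?ss' ?subrr // eq_sym.
rewrite unitfE; apply/prodf_neq0 => s _; apply/prodf_neq0 => s' nss'.
by rewrite subr_eq0; apply: contra nss' => /eqP/h3->.
Qed.

Lemma emis_other t s b : #|Sigma| = 2%N -> unit_sums t -> b != enum_rank a0 ->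
  emis t s b = 1 - emis0 t 0 s.
Proof.
move=> h2 [_ hE _] hb; by rewrite mxE -(two_terms_sum h2 (hE s) hb) addrK.
Qed.

End Identifiability.

(** * Uniqueness up to permutation, and definability of the parameter conditions *)

Section IdentifiableStates.
Variables (R : realType) (Sigma : finType) (d : nat) (a0 : Sigma).
Hypothesis hSigma : #|Sigma| = 2%N.
Implicit Types (t : hmp_triple R Sigma d.+1).

(** The data needed come from words [a0^i w a0^j] with [w] of length at most 1 and [i], [j] at most
    [d]; their length is at most [2d + 1], which is at most [n]. *)
Lemma identifiable_perm n t t' : unit_sums t -> unit_sums t' ->
  (2 * d.+1 <= n + 1)%N ->
  (forall v, size v = n -> word_val t v = word_val t' v) ->
  identifiable a0 t ->
  identifiable a0 t' /\ exists g, t' = permute_states g t.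
Proof.
move=> ht ht' dn hv [uH uM ie].
have agree := word_val_shorter ht ht' hv.
have ij (i j : 'I_d.+1) : ((i + j).+1 <= n)%N.
  by have := ltn_ord i; have := ltn_ord j; lia.
have eH : hankel_mx a0 t = hankel_mx a0 t'.
  apply/matrixP => i j; rewrite /hankel_mx.
  rewrite -[X in X *m _]mulmx1 -[X in _ = (X *m _) _ _]mulmx1.
  rewrite !ctrl_mul_obs !mulmx1 -!word_mx_nseq -!word_mx_cat.
  by apply: agree; rewrite size_cat !size_nseq ltnW.
have eT : ctrl_mx (init t) (letter_mx t a0) *m letter_mx t a0 *m
      obs_mx (letter_mx t a0) =
    ctrl_mx (init t') (letter_mx t' a0) *m letter_mx t' a0 *m
      obs_mx (letter_mx t' a0).
  apply/matrixP => i j; rewrite !ctrl_mul_obs -!word_mx_nseq.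
  rewrite -![letter_mx _ a0]word_mx1 -!word_mx_cat.
  by apply: agree; rewrite !size_cat !size_nseq addn1 addSn.
(* The matrix [M] in the middle is obtained by summing over the middle letter. *)
have eM : ctrl_mx (init t) (letter_mx t a0) *m trans t *m
      obs_mx (letter_mx t a0) =
    ctrl_mx (init t') (letter_mx t' a0) *m trans t' *m
      obs_mx (letter_mx t' a0).
  apply/matrixP => i j; rewrite !ctrl_mul_obs -!word_mx_nseq.
  rewrite -!sum_word_val_cat //; apply: eq_bigr => a _.
  by apply: agree; rewrite size_cat /= !size_nseq addnS.
have [g [gM gp ge]] := realization_perm uH uM ie eH eT eM.
split; last exists g.
  split; first by rewrite -eH.
    by rewrite gM row_permE col_permE !unitmx_mul !unitmx_perm uM.
  by move=> s s'; rewrite !ge => /ie /perm_inj.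
have gE : emis t' = row_perm g (emis t).
  apply/matrixP => s b; rewrite mxE.
  have [->|hb] := eqVneq b (enum_rank a0); first by have := ge s; rewrite !mxE.
  by rewrite !(emis_other _ hSigma _ hb) // ge.
by case: t' gM gp gE {ht' hv agree eH eT eM ge} => M E p /= -> -> ->.
Qed.

Lemma exprmx_diag (e : 'rV[R]_d.+1) k :
  diag_mx e ^+ k = diag_mx (\row_s e 0 s ^+ k).
Proof.
elim: k => [|k IH].
  by apply/matrixP => i j; rewrite expr0 !mxE expr0.
rewrite exprS IH -mulmxE mulmx_diag; congr diag_mx.
by apply/rowP => s; rewrite !mxE exprS.
Qed.

(** Identity transitions, emission values [0, ..., d] for [a0] and uniform initial entries: the
    Hankel matrix is a multiple of [V V^T] for an invertible Vandermonde matrix [V]. Negative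
    emissions do no harm, as only unit sums are asked for. *)
Lemma identifiable_exists : exists t, unit_sums t /\ identifiable a0 t.
Proof.
pose e : 'rV[R]_d.+1 := \row_s s%:R.
pose t : hmp_triple R Sigma d.+1 := HmpTriple 1%:M
  (\matrix_(s, b) if b == enum_rank a0 then e 0 s else 1 - e 0 s)
  (const_mx d.+1%:R^-1).
have e0E : emis0 a0 t = e by apply/rowP => s; rewrite !mxE eqxx.
have ie : injective (e 0).
  move=> s s'; rewrite !mxE => /eqP; rewrite eqr_nat => /eqP.
  exact: val_inj.
have d0 : d.+1%:R != 0 :> R by rewrite pnatr_eq0.
have cS : (1 < #|Sigma|)%N by rewrite hSigma.
exists t; split; split.
- move=> i; rewrite (bigD1 i) //= big1 => [|j ji].
    by rewrite mxE eqxx addr0.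
  by rewrite mxE eq_sym (negPf ji).
- have [b hb] : exists b, b != enum_rank a0.
    have := cS; rewrite -[X in (1 < X)%N]card_ord.
    case/card_gt1P => b [b' [_ _ bb']].
    by have [hb|] := eqVneq b (enum_rank a0);
      [exists b'; rewrite -hb eq_sym|exists b].
  move=> s; rewrite -(two_terms_sum hSigma erefl hb) !mxE eqxx (negPf hb).
  by rewrite subrK.
- under eq_bigr do rewrite mxE.
  by rewrite sumr_const card_ord -[LHS]mulr_natr mulVf.
- have letE : letter_mx t a0 = diag_mx e by rewrite /letter_mx mulmx1 -e0E.
  rewrite /hankel_mx letE.
  have -> : obs_mx (diag_mx e) = (Vandermonde d.+1 e)^T.
    by apply/matrixP => i j; rewrite mxE exprmx_diag mul_diag_mx !mxE mulr1.
  have -> : ctrl_mx (init t) (diag_mx e) = d.+1%:R^-1 *: Vandermonde d.+1 e.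
    by apply/matrixP => i j; rewrite mxE exprmx_diag mul_mx_diag !mxE.
  rewrite -scalemxAl unitmxZ ?unitrV ?unitfE // unitmx_mul unitmx_tr andbb.
  rewrite unitmxE det_Vandermonde unitfE; apply/prodf_neq0 => i _.
  apply/prodf_neq0 => j ij; rewrite subr_eq0.
  by apply: contraTneq ij => /ie->; rewrite ltnn.
- exact: unitmx1.
- by rewrite e0E.
Qed.

Definition polytriple (F : store R -> hmp_triple R Sigma d.+1) : Prop :=
  [/\ polymx (fun s => trans (F s)), polymx (fun s => emis (F s))
    & polymx (fun s => init (F s))].

Variable F : store R -> hmp_triple R Sigma d.+1.
Hypothesis hF : polytriple F.

Lemma polymx_letter a : polymx (fun s => letter_mx (F s) a).
Proof.
have [hM hE _] := hF; apply: polymx_mul => // i j.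
apply: (@polyfun_ext _ (fun s => emis (F s) i (enum_rank a) * (i == j)%:R)).
  by move=> s; rewrite !mxE mulr_natr.
by apply: polyfun_mul => //; apply: polyfun_nat.
Qed.

Lemma polymx_trmx m n (A : store R -> 'M[R]_(m, n)) : polymx A ->
  polymx (fun s => (A s)^T).
Proof.
by move=> hA i j; apply: polyfun_ext (hA j i) => s; rewrite mxE.
Qed.

Lemma polymx_one m n : polymx (fun=> const_mx 1 : 'M[R]_(m, n)).
Proof.
by move=> i j; apply: polyfun_ext (polyfun_nat R 1) => s; rewrite mxE.
Qed.

Lemma polymx_id n : polymx (fun=> 1%:M : 'M[R]_n).
Proof.
by move=> i j; apply: polyfun_ext (polyfun_nat R (i == j)) => s; rewrite !mxE.
Qed.

Lemma polymx_exp k (A : store R -> 'M[R]_d.+1) : polymx A ->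
  polymx (fun s => A s ^+ k).
Proof.
move=> hA; elim: k => [|k IH]; first exact: polymx_id.
by move=> i j; apply: polyfun_ext (polymx_mul hA IH i j) => s; rewrite exprS.
Qed.

Lemma polyfun_word_val v : polyfun (fun s => word_val (F s) v).
Proof.
have [_ _ hp] := hF; rewrite /word_val.
have hw : polymx (fun s => word_mx (F s) v).
  elim: v => [|a v IH] i j.
    apply: polyfun_ext (@polymx_id d.+1 i j) => s.
    by rewrite /word_mx big_nil.
  apply: polyfun_ext (polymx_mul (polymx_letter a) IH i j) => s.
  by rewrite /word_mx big_cons.
exact: (polymx_mul (polymx_mul (polymx_trmx hp) hw) (@polymx_one _ _) 0 0).
Qed.

Lemma polyfun_singularity : polyfun (fun s => singularity a0 (F s)).
Proof.
have [hM hE hp] := hF.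
have hl := polymx_letter a0.
apply: polyfun_mul; [apply: polyfun_mul; apply: polyfun_det => //|].
  apply: polymx_mul => i j.
    apply: polyfun_ext (polymx_mul (polymx_trmx hp) (polymx_exp i hl) 0 j) => s.
    by rewrite [RHS]mxE.
  apply: polyfun_ext (polymx_mul (polymx_exp j hl) (@polymx_one _ _) i 0) => s.
  by rewrite [RHS]mxE.
apply: polyfun_prod => s; apply: polyfun_prod => s'.
have he u : polyfun (fun st => emis0 a0 (F st) 0 u).
  by apply: polyfun_ext (hE u (enum_rank a0)) => st; rewrite mxE.
by apply: polyfun_add => //; apply: polyfun_opp.
Qed.

Lemma definable_is_hmp : definable (fun s => is_hmp (F s)).
Proof.
have [hM hE hp] := hF.
have ge0 (G : store R -> R) : polyfun G -> definable (fun s => 0 <= G s).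
  by move=> hG; apply: definable_le (polyfun_nat R 0) hG.
have eq1 (G : store R -> R) : polyfun G -> definable (fun s => G s = 1).
  by move=> hG; apply: definable_eq hG (polyfun_nat R 1).
pose S s := ((((forall i j, 0 <= trans (F s) i j) /\
  (forall i, \sum_j trans (F s) i j = 1)) /\
  ((forall i j, 0 <= emis (F s) i j) /\
  (forall i, \sum_j emis (F s) i j = 1))) /\
  ((forall i, 0 <= init (F s) i 0) /\ \sum_i init (F s) i 0 = 1)).
apply: (@definable_iff _ S) => [s|].
  by split=> [[[h1 h2] h3]|[h1 h2 h3]].
by do ![apply: definable_and|apply: definable_forall => ?];
  do ?[apply: ge0|apply: eq1]; do ?apply: polyfun_sum.
Qed.

End IdentifiableStates.

(** * From terms to multivariate polynomials *)

Section PolynomialOfTerm.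
Variables (R : realType) (D : nat).

Definition store_of (x : 'rV[R]_D) : store R :=
  fun i => if insub i is Some j then x 0 j else 0.

Lemma stored_point0 x : stored_point D 0 (store_of x) = x.
Proof. by apply/rowP => i; rewrite mxE /store_of add0n valK. Qed.

Fixpoint mpoly_of (t : tm rat) : {mpoly R[D]} :=
  match t with
  | qe_rcf.Var i => if insub i is Some j then 'X_j else 0
  | qe_rcf.Const c => (ratr c)%:MP
  | qe_rcf.NatConst n => n%:R
  | qe_rcf.Add a b => mpoly_of a + mpoly_of b
  | qe_rcf.Opp a => - mpoly_of a
  | qe_rcf.NatMul a n => mpoly_of a *+ n
  | qe_rcf.Mul a b => mpoly_of a * mpoly_of b
  | qe_rcf.Exp a n => mpoly_of a ^+ n
  end.

Lemma meval_mpoly_of t (x : 'rV[R]_D) :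
  (mpoly_of t).@[x 0] = teval (store_of x) t.
Proof.
elim: t => /= [i|c|n|a <- b <-|a <-|a <- n|a <- b <-|a <- n].
- by rewrite /store_of; case: insub => [j|]; rewrite ?mevalXU ?meval0.
- exact: mevalC.
- exact: rmorph_nat.
- exact: mevalD.
- exact: mevalN.
- exact: mevalMn.
- exact: mevalM.
- exact: rmorphXn.
Qed.

(** Supplies the equation of the singular hypersurface from the closure properties of [polyfun]. *)
Lemma polyfun_mpoly (G : 'rV[R]_D -> R) :
  polyfun (fun s => G (stored_point D 0 s)) ->
  exists p : {mpoly R[D]}, forall x : 'rV[R]_D, p.@[x 0] = G x.
Proof.
move=> [t ht]; exists (mpoly_of t) => x.
by rewrite meval_mpoly_of -ht stored_point0.
Qed.

End PolynomialOfTerm.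

(** * Parameters and distributions read from a store *)

Section StoredPoints.
Variables (R : realType) (Sigma : finType) (d n off : nat).
Notation D := (param_dim d.+1 #|Sigma|).

Lemma polyfun_complete_sum1 m (v : store R -> 'I_m.-1 -> R) j :
  (forall k, polyfun (fun s => v s k)) ->
  polyfun (fun s => complete_sum1 (v s) j).
Proof.
move=> hv; rewrite /complete_sum1; case: insub => [k|] //.
apply: (@polyfun_add _ (fun=> 1)); first exact: (polyfun_nat R 1).
by apply: polyfun_opp; apply: polyfun_sum.
Qed.

Lemma polytriple_stored :
  polytriple (fun s => @triple_of R Sigma d.+1 (stored_point D off s)).
Proof.
have var k : polyfun (fun s : store R => stored_point D off s 0 k).
  by apply: polyfun_ext (polyfun_var R (off + k)) => s; rewrite mxE.
split=> i j.
- pose v (s : store R) :=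
    (vec_mx (lsubmx (lsubmx (stored_point D off s))) : 'M_(d.+1, d)) i.
  apply: (@polyfun_ext _ (fun s => @complete_sum1 R d.+1 (v s) j)).
    by move=> s; rewrite mxE.
  apply: polyfun_complete_sum1 => k.
  by apply: polyfun_ext (var (lshift _ (lshift _ (mxvec_index i k)))) => s;
    rewrite /v !mxE.
- pose v (s : store R) := (vec_mx (rsubmx (lsubmx (stored_point D off s)))
    : 'M_(d.+1, #|Sigma|.-1)) i.
  apply: (@polyfun_ext _ (fun s => complete_sum1 (v s) j)).
    by move=> s; rewrite mxE.
  apply: polyfun_complete_sum1 => k.
  by apply: polyfun_ext (var (lshift _ (rshift _ (mxvec_index i k)))) => s;
    rewrite /v !mxE.
- pose v (s : store R) := (rsubmx (stored_point D off s) : 'rV_d) 0.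
  apply: (@polyfun_ext _ (fun s => @complete_sum1 R d.+1 (v s) i)).
    by move=> s; rewrite mxE.
  apply: polyfun_complete_sum1 => k.
  by apply: polyfun_ext (var (rshift _ k)) => s; rewrite /v !mxE.
Qed.

Definition stored_dist (s : store R) : {ffun n.-tuple Sigma -> R} :=
  [ffun v => s (enum_rank v)].

Lemma stored_dist_input P : stored_dist (input P) = P.
Proof. by apply/ffunP => v; rewrite ffunE /input nth_image enum_rankK. Qed.

Lemma stored_dist_agree s s' : (#|{: n.-tuple Sigma}| <= off)%N ->
  (forall r, (r < off)%N -> s r = s' r) -> stored_dist s = stored_dist s'.
Proof.
move=> ho h; apply/ffunP => v; rewrite !ffunE; apply: h.
exact: leq_trans (ltn_ord _) ho.
Qed.

Lemma definable_word_map :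
  definable (fun s => word_map n (stored_point D off s) = stored_dist s).
Proof.
apply: (@definable_iff _ (fun s => forall v : n.-tuple Sigma,
  word_val (triple_of (stored_point D off s)) v = s (enum_rank v))) => [s|].
  split=> [h|/ffunP h v]; last by have := h v; rewrite !ffunE.
  apply/ffunP => v; rewrite !ffunE; apply: h.
apply: definable_forall => v; apply: definable_eq; last exact: polyfun_var.
exact: polyfun_word_val polytriple_stored _.
Qed.

End StoredPoints.

(** * The singular hypersurface and its decision procedure *)

Theorem theorem1p3 (R : realType) (Sigma : finType) (hSigma : #|Sigma| = 2%N)
    (d : nat) (hd : (1 <= d)%N) :
  exists N : set 'rV[R]_(param_dim d #|Sigma|),
    [/\ algebraic N,
        dim_lt N (d ^ 2 + d - 1)
      & forall n : nat, (1 <= n)%N -> (2 * d <= n + 1)%N ->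
        exists A : program,
        forall P : {ffun n.-tuple Sigma -> R}, is_distribution P ->
        exists2 s : store R, exec A (input P) s &
          [/\ (@word_map R Sigma d n @` (Hplus R Sigma d `\` N)) P ->
                let x := output_point (param_dim d #|Sigma|) s in
                [/\ answers s IsHMP,
                    Hplus R Sigma d x,
                    word_map n x = P
                  & forall y, Hplus R Sigma d y -> word_map n y = P ->
                    exists g : 'S_d,
                      triple_of y = permute_states g (triple_of x)],
              (@word_map R Sigma d n @` N) P -> answers s CannotDecide
            & ~ (@word_map R Sigma d n @` (Hplus R Sigma d `\` N)) P ->
              ~ (@word_map R Sigma d n @` N) P -> answers s NoHMP]].
Proof.
case: d hd => // d _; have Sigma0 : (0 < #|Sigma|)%N by rewrite hSigma.
have [a0 _] := card_gt0P Sigma0.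
pose D := param_dim d.+1 #|Sigma|.
pose sing (x : 'rV[R]_D) := singularity a0 (triple_of x).
have us (x : 'rV[R]_D) : unit_sums (triple_of x) by apply: unit_sums_triple_of.
have [q hq] : exists q : {mpoly R[D]}, forall x : 'rV[R]_D, q.@[x 0] = sing x.
  apply: polyfun_mpoly; apply: polyfun_singularity; exact: polytriple_stored.
pose N : set 'rV[R]_D := [set x | q.@[x 0] = 0].
exists N; split.
- by exists [set q]; apply/seteqP; split=> [x qx p ->|x]; last apply.
- rewrite -param_dim2 // -[in X in dim_lt _ X]hSigma.
  apply: dim_lt_hypersurface.
  (* The equation is nonzero because some triple with unit sums is identifiable. *)
  apply/eqP => q0; have [t [ht /(singularityP a0)]] :=
    identifiable_exists R d a0 hSigma.
  by rewrite -{1}(coords_ofK ht) -/(sing _) -hq q0 meval0 eqxx.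
move=> n _ dn.
(* Off [N], the fibre in the whole parameter space consists of permutations of one point and avoids
   [N]. This gives finiteness, uniqueness and disjointness of the first two cases. *)
have perm (x y : 'rV[R]_D) : sing x != 0 -> word_map n x = word_map n y ->
    sing y != 0 /\ exists g, triple_of y = permute_states g (triple_of x).
  move=> /singularityP ix xy.
  have [|iy hg] := identifiable_perm hSigma (us x) (us y) dn _ ix.
    move=> v vn; have := congr1 (fun f : {ffun n.-tuple Sigma -> R} =>
      f (Tuple (introT eqP vn))) xy.
    by rewrite !ffunE.
  by split=> //; apply/singularityP.
(* The point is searched for beyond the input registers and beyond the output registers 0 to [D]. *)
pose off := (maxn #|{: n.-tuple Sigma}| D).+1.
have [Doff cardoff] : (D < off)%N /\ (#|{: n.-tuple Sigma}| <= off)%N.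
  by rewrite /off ltnS leq_maxr leqW ?leq_maxl.
pose Fib (s : store R) (x : 'rV[R]_D) :=
  [/\ Hplus R Sigma d.+1 x, sing x != 0 & word_map n x = stored_dist Sigma n s].
(* No sign condition here: [N] is taken in the whole parameter space. *)
pose FibN (s : store R) (x : 'rV[R]_D) :=
  sing x = 0 /\ word_map n x = stored_dist Sigma n s.
have dsing : definable (fun s => sing (stored_point D off s) = 0).
  apply: definable_eq (polyfun_nat R 0).
  exact: polyfun_singularity (polytriple_stored _ _ _ _).
have dword := @definable_word_map R Sigma d n off.
have FibA s s' x : (forall r, (r < off)%N -> s r = s' r) -> Fib s x -> Fib s' x.
  by move=> h; rewrite /Fib (stored_dist_agree cardoff h).
have FibNA s s' x :
    (forall r, (r < off)%N -> s r = s' r) -> FibN s x -> FibN s' x.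
  by move=> h; rewrite /FibN (stored_dist_agree cardoff h).
have FibD : definable (fun s => Fib s (stored_point D off s)).
  apply: (@definable_iff _ (fun s =>
    (Hplus R Sigma d.+1 (stored_point D off s) /\
      ~ sing (stored_point D off s) = 0) /\
    word_map n (stored_point D off s) = stored_dist Sigma n s)) => [s|].
    by split=> [[[h1 /eqP h2] h3]|[h1 /eqP h2 h3]].
  apply: definable_and dword; apply: definable_and; last exact: definable_not.
  exact: definable_is_hmp (polytriple_stored _ _ _ _).
have FibND : definable (fun s => FibN s (stored_point D off s)).
  exact: definable_and dsing dword.
(* With no coordinate prescribed, the prefix condition says that the fibre meets [N]. *)
have SD := definable_prefix_extends FibNA FibND (leq0n D).
have [A hA] := decision_program FibA FibD Doff SD.
exists A => P _; have [|s [es s1 s2 s3]] := hA (input P).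
  have [[x [hx ix xP]]|nx] := pselect (exists x, Fib (input P) x); last first.
    by exists [::] => x hx; case: nx; exists x.
  (* A nonempty fibre is contained in the finite list of permutations of one of its points. *)
  exists [seq coords_of (permute_states g (triple_of x)) | g : 'S_d.+1].
  move=> y [_ _ yP]; have [_ [g gy]] := perm x y ix (etrans xP (esym yP)).
  by apply/mapP; exists g; rewrite ?mem_enum // -gy triple_ofK.
have inFib : (exists x, Fib (input P) x) <->
    (@word_map R Sigma d.+1 n @`
      (Hplus R Sigma d.+1 `\` N)) P.
  rewrite /Fib stored_dist_input; split.
    move=> [x [hx ix xP]]; exists x => //.
    by split=> //; rewrite /N /= hq; apply/eqP.
  by move=> [x [hx /= /eqP ix] xP]; exists x; split=> //; rewrite -hq.
have inFibN : prefix_extends off FibN 0 (input P) <->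
    (@word_map R Sigma d.+1 n @` N) P.
  rewrite /prefix_extends /FibN stored_dist_input; split.
    by move=> [x [ix xP] _]; exists x => //; rewrite /N /= hq.
  by move=> [x /= ix xP]; exists x => //; rewrite -hq.
exists s => //; split.
- move=> /inFib/s1[ans]; rewrite /Fib stored_dist_input => -[hx ix xP].
  split=> // y _ yP.
  by have [_] := perm _ y ix (etrans xP (esym yP)).
(* A point of the fibre on [N] excludes any point of it off [N], so the first test fails. *)
- move=> hN; apply: s2; last exact/inFibN.
  move=> [x [_ ix]]; rewrite stored_dist_input => xP.
  have [y /= qy yP] := hN.
  have [] := perm x y ix (etrans xP (esym yP)).
  by rewrite -hq qy eqxx.
- by move=> h1 h2; apply: s3; rewrite ?inFib ?inFibN.
Qed.
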